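(* There exist constants $b$ and $q_0$ such that the following holds for $q\ge q_0$. Let $G=\mathrm{SL}(2,q)$, let $k\ge1$ and $t$ be integers, $m=2^k$, and $t\ge b^m$. Let $x_1^0,x_1^1,\dots,x_k^0,x_k^1$ be chosen independently and uniformly from $G^t$, and let $\mu$ be the distribution on $G^m=G^{\{0,1\}^k}$ whose coordinate indexed by $\epsilon\in\{0,1\}^k$ is the interleaved product $x_1^{\epsilon_1}\bullet x_2^{\epsilon_2}\bullet\cdots\bullet x_k^{\epsilon_k}$. Then $\mu$ is $(|G|^{-t/b^m},m)$-good.
   Context: For $x_1,\dots,x_k\in G^t$ with $x_i=(a_{i1},\dots,a_{it})$, the interleaved product is $x_1\bullet\cdots\bullet x_k=a_{11}a_{21}\cdots a_{k1}a_{12}\cdots a_{k2}\cdots a_{1t}\cdots a_{kt}$. A distribution $D$ on $G^m$ is $(\epsilon,k')$-good if for any $k'$ distinct coordinates $i_1<\dots<i_{k'}$ and any $g_1,\dots,g_{k'}\in G$, the probability that $x_{i_j}=g_j$ for all $j$ lies between $(1-\epsilon)|G|^{-k'}$ and $(1+\epsilon)|G|^{-k'}$. $\mathrm{SL}(2,q)$ is the group of $2\times2$ determinant-one matrices over $\mathbb F_q$. *)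

(* Defs.v *)
From mathcomp Require Import all_boot all_algebra.
Set Implicit Arguments. Unset Strict Implicit. Unset Printing Implicit Defensive.
Import GRing.Theory.

Section SL2Defs.
Local Open Scope ring_scope.
Variable F : finFieldType.

Definition SL2 : finType := {M : 'M[F]_2 | \det M == 1}.

Lemma SL2_prod_det (r : seq SL2) : \det (\prod_(g <- r) val g) == 1.
Proof.
elim: r => [|g r IH]; first by rewrite big_nil det1.
by rewrite big_cons det_mulmx (eqP (valP g)) (eqP IH) mul1r.
Qed.

Definition SL2_prod (r : seq SL2) : SL2 := exist (fun M : 'M[F]_2 => \det M == 1) _ (SL2_prod_det r).

Definition interleave (k t : nat) (x : 'I_k -> t.-tuple SL2) : SL2 :=
  SL2_prod [seq tnth (x i) j | j <- enum 'I_t, i <- enum 'I_k].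

(* Sample space: x_i^b in G^t for i < k, b in {0,1}, chosen independently
   and uniformly = uniform measure on this finite type. *)
Definition sample_space (k t : nat) : finType :=
  {ffun 'I_k -> {ffun bool -> t.-tuple SL2}}.

Definition mu_coord (k t : nat) (w : sample_space k t)
  (e : {ffun 'I_k -> bool}) : SL2 :=
  interleave (fun i => w i (e i)).
End SL2Defs.

From Stdlib Require Import Reals.

Definition prob (Om : finType) (P : pred Om) : R :=
  Rdiv (INR #|P|) (INR #|Om|).

(* A distribution on G^I, given as a random variable X on a uniform finite
   sample space, is (eps,k')-good if for every set S of k' distinct
   coordinates and every choice of values g_i (i in S), the probability that
   X_i = g_i for all i in S lies between (1-eps)|G|^{-k'} and (1+eps)|G|^{-k'}. *)
Definition good (G I Om : finType) (X : Om -> I -> G) (eps : R) (k' : nat)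
  : Prop :=
  forall (S : {set I}), #|S| = k' ->
  forall (g : I -> G),
    Rle (Rmult (Rminus 1 eps) (Rinv (pow (INR #|G|) k')))
        (prob (fun w => [forall i in S, X w i == g i])) /\
    Rle (prob (fun w => [forall i in S, X w i == g i]))
        (Rmult (Rplus 1 eps) (Rinv (pow (INR #|G|) k'))).

(* Main.v *)
Require Import Defs.
From HB Require Import structures.
From mathcomp Require Import all_boot all_order all_algebra all_fingroup ring lra zify.
Set Implicit Arguments. Unset Strict Implicit. Unset Printing Implicit Defensive.
Import Order.TTheory GRing.Theory Num.Theory.
Local Open Scope ring_scope.

(** The distribution of one column [(x_1^{e_1} ... x_k^{e_k})_e] is convolved with
itself [t] times.  Splitting off the first factor, the two halves of the cube
are two conditionally independent walks [D(x_1) h_1 ... D(x_n) h_n], where [D]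
is the diagonal and the [h_j] are independent samples for [k - 1].  By AM-GM the
deviation from uniformity is controlled by a second moment, where each [h_j]
can be replaced, by induction, by a uniform element.  What remains is the
probability that [D(x_1) h_1 ... D(x_n) h_n = D(x'_1) h_1 ... D(x'_n) h_n],
which factors over the coordinates of the cube into the probability that a
product of random conjugates of [y_j = x_j / x'_j] is trivial.  The convolution
operator of two random conjugates [y^g y'^h] contracts mean-zero functions, on
average over [y, y'], by [O(q^(-1/2))]: its Hilbert-Schmidt norm counts the
solutions of [[a, b] = [c, d]], bounded by [a^b = a z -> tr (a z) = tr a], a
quadric section with about [q^2] points, times a centralizer of about [q]
points. *)

(** A letter is a block of consecutive columns, close to uniform by induction. Replacing [n] letters
    by uniform ones costs a factor [(1 + d) ^+ n], so blocks are made long enough that [d] is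
    [|G|^(-2n)]. The number of letters has to be proportional to [2^k]: the collision probability is
    a [2^k]-th moment of the probability that a product of conjugates is trivial, and, relative to
    [1/|G|], that probability is as large as [|G|] when every [y_j] is trivial. The average
    contraction must therefore beat [|G|^(2^k)].

    Conjugates are grouped in pairs because a single one is confined to a class of about [q^2] of
    the [q^3] elements. Its Hilbert-Schmidt norm exceeds 1 and yields no contraction, whereas a
    product of two conjugates spreads over the whole group. Central elements never contract, which
    is why the estimate is only an average over [y] and [y']. Counting commutators gives it without
    any character theory. *)

(** * Iterated sums and convolution on finite groups *)

Section IteratedSums.
Variable R : realFieldType.

(** Expectation over [n] independent letters of law [w]. The recursion lets inductions split off the
    first letter; [iterE_unif_ffun] returns to counting finite functions. *)
Fixpoint iterE (T : finType) (w : T -> R) (n : nat) (F : seq T -> R) : R :=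
  if n is n'.+1 then \sum_a w a * iterE w n' (fun s => F (a :: s)) else F [::].

Lemma iterES (T : finType) (w : T -> R) n F :
  iterE w n.+1 F = \sum_a w a * iterE w n (fun s => F (a :: s)).
Proof. by []. Qed.

Definition unif (T : finType) (_ : T) : R := #|T|%:R^-1.

Lemma unif_ge0 (T : finType) (a : T) : 0 <= unif a.
Proof. by rewrite invr_ge0 ler0n. Qed.

Lemma card_neq0 (T : finType) (a : T) : #|T|%:R != 0 :> R.
Proof. by rewrite pnatr_eq0 -lt0n; apply/card_gt0P; exists a. Qed.

Lemma card_fin_gt0 (T : finType) (a : T) : 0 < #|T|%:R :> R.
Proof. by rewrite lt0r (card_neq0 a) ler0n. Qed.

Lemma sum_unif (T : finType) (a : T) : \sum_(x : T) unif x = 1.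
Proof. by rewrite sumr_const -[LHS]mulr_natl divff // card_neq0. Qed.

Lemma sum_delta (T : finType) (F : T -> R) (a : T) :
  \sum_x (x == a)%:R * F x = F a.
Proof.
rewrite (bigD1 a) //= eqxx mul1r big1 ?addr0 // => x /negbTE ->.
by rewrite mul0r.
Qed.

Lemma eq_iterE (T : finType) (w : T -> R) n F F' :
  (forall s, size s = n -> F s = F' s) -> iterE w n F = iterE w n F'.
Proof.
elim: n F F' => [|n IH] F F' eqF /=; first exact: eqF.
apply: eq_bigr => a _; congr (_ * _); apply: IH => s sz_s.
by apply: eqF; rewrite /= sz_s.
Qed.

Lemma iterE_le (T : finType) (w : T -> R) n F F' : (forall a, 0 <= w a) ->
  (forall s, size s = n -> F s <= F' s) -> iterE w n F <= iterE w n F'.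
Proof.
move=> w0; elim: n F F' => [|n IH] F F' leF /=; first exact: leF.
apply: ler_sum => a _; apply: ler_wpM2l => //; apply: IH => s sz_s.
by apply: leF; rewrite /= sz_s.
Qed.

Lemma iterED (T : finType) (w : T -> R) n F F' :
  iterE w n (fun s => F s + F' s) = iterE w n F + iterE w n F'.
Proof.
elim: n F F' => [|n IH] F F' //=; rewrite -big_split /=.
by apply: eq_bigr => a _; rewrite IH mulrDr.
Qed.

Lemma iterEZ (T : finType) (w : T -> R) n c F :
  iterE w n (fun s => c * F s) = c * iterE w n F.
Proof.
elim: n F => [|n IH] F //=; rewrite big_distrr /=.
by apply: eq_bigr => a _; rewrite IH mulrCA.
Qed.

Lemma iterEZr (T : finType) (w : T -> R) n c F :
  iterE w n (fun s => F s * c) = iterE w n F * c.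
Proof.
by rewrite mulrC -iterEZ; apply: eq_iterE => s _; rewrite mulrC.
Qed.

Lemma iterE_const (T : finType) (w : T -> R) n c :
  \sum_a w a = 1 -> iterE w n (fun=> c) = c.
Proof. by move=> w1; elim: n => //= n ->; rewrite -big_distrl /= w1 mul1r. Qed.

Lemma iterE_ge0 (T : finType) (w : T -> R) n F : (forall a, 0 <= w a) ->
  (forall s, 0 <= F s) -> 0 <= iterE w n F.
Proof.
move=> w0; elim: n F => [|n IH] F F0 /=; first exact: F0.
by apply: sumr_ge0 => a _; rewrite mulr_ge0 // IH.
Qed.

(** This exchanges a near-uniform law for the uniform one, at the price of a factor [c] per
    letter. *)
Lemma iterE_dominated (T : finType) (w w' : T -> R) c n F : 0 <= c ->
  (forall a, 0 <= w a) -> (forall a, 0 <= w' a) ->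
  (forall a, w a <= c * w' a) -> (forall s, 0 <= F s) ->
  iterE w n F <= c ^+ n * iterE w' n F.
Proof.
move=> c0 w0 w'0 le_w; elim: n F => [|n IH] F F0 /=; first by rewrite mul1r.
rewrite big_distrr /=; apply: ler_sum => a _.
have -> : c ^+ n.+1 * (w' a * iterE w' n (fun s => F (a :: s))) =
   (c * w' a) * (c ^+ n * iterE w' n (fun s => F (a :: s))).
  by rewrite exprS; ring.
by apply: ler_pM => //; [apply: iterE_ge0 | apply: IH].
Qed.

Definition pushw (T U : finType) (f : T -> U) (w : T -> R) (u : U) : R :=
  \sum_(a | f a == u) w a.

Lemma sum_pushw (T U : finType) (f : T -> U) (w : T -> R) (F : U -> R) :
  \sum_u pushw f w u * F u = \sum_a w a * F (f a).
Proof.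
rewrite (partition_big f predT) //=; apply: eq_bigr => u _.
by rewrite big_distrl /=; apply: eq_bigr => a /eqP ->.
Qed.

Lemma iterE_push (T U : finType) (f : T -> U) (w : T -> R) n F :
  iterE w n (fun s => F (map f s)) = iterE (pushw f w) n F.
Proof.
elim: n F => [|n IH] F //=; rewrite sum_pushw.
by apply: eq_bigr => a _; rewrite -IH.
Qed.

Lemma iterE_sum (I T : finType) (w : T -> R) n (F : I -> seq T -> R) :
  iterE w n (fun s => \sum_i F i s) = \sum_i iterE w n (F i).
Proof.
elim: n F => [|n IH] F //=; rewrite exchange_big /=.
by apply: eq_bigr => a _; rewrite IH big_distrr.
Qed.

Lemma iterE_exchange (T U : finType) (w : T -> R) (v : U -> R) n m F :
  iterE w n (fun s => iterE v m (F s)) =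
  iterE v m (fun t => iterE w n (fun s => F s t)).
Proof.
elim: n F => [|n IH] F //=; rewrite iterE_sum; apply: eq_bigr => a _.
by rewrite iterEZ IH.
Qed.

Lemma iterE_pair (T U : finType) (w : T -> R) (v : U -> R) n F F' :
  iterE (fun c : T * U => w c.1 * v c.2) n
    (fun s => F (map fst s) * F' (map snd s)) = iterE w n F * iterE v n F'.
Proof.
elim: n F F' => [|n IH] F F' //=; rewrite big_distrlr /= pair_bigA /=.
apply: eq_bigr => -[a b] _ /=.
by rewrite (IH (fun s => F (a :: s)) (fun s => F' (b :: s))); ring.
Qed.

Lemma unif_pair (T U : finType) (c : T * U) : unif c = unif c.1 * unif c.2.
Proof. by rewrite /unif card_prod natrM invfM. Qed.

Lemma eq_iterEw (T : finType) (w w' : T -> R) n F :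
  w =1 w' -> iterE w n F = iterE w' n F.
Proof.
move=> eqw; elim: n F => //= n IH F.
by apply: eq_bigr => a _; rewrite IH eqw.
Qed.

Lemma iterE_unif_pair (T U : finType) n F F' :
  iterE (@unif (T * U)%type) n (fun s => F (map fst s) * F' (map snd s)) =
  iterE (@unif T) n F * iterE (@unif U) n F'.
Proof. by rewrite -iterE_pair; apply: eq_iterEw => c; rewrite unif_pair. Qed.

End IteratedSums.

Section Convolution.
Variables (R : realFieldType) (gT : finGroupType).
Implicit Types (f g : gT -> R).

Definition conv f g (z : gT) : R := \sum_a f a * g (a^-1 * z)%g.

Fixpoint cpow f n : gT -> R :=
  if n is n'.+1 then conv f (cpow f n') else fun z => (z == 1%g)%:R.

Lemma eq_conv f f' g g' : f =1 f' -> g =1 g' -> conv f g =1 conv f' g'.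
Proof. by move=> ef eg z; apply: eq_bigr => a _; rewrite ef eg. Qed.

Lemma convA f g k : conv (conv f g) k =1 conv f (conv g k).
Proof.
move=> z; rewrite /conv.
under eq_bigr do rewrite big_distrl /=.
rewrite exchange_big /=; apply: eq_bigr => a _; rewrite big_distrr /=.
rewrite (reindex_inj (mulgI a)) /=; apply: eq_bigr => b _.
by rewrite mulKg invMg !mulgA mulrA.
Qed.

Lemma conv1f f : conv (fun z => (z == 1%g)%:R) f =1 f.
Proof. by move=> z; rewrite /conv sum_delta invg1 mul1g. Qed.

Lemma cpowD f m n : cpow f (m + n) =1 conv (cpow f m) (cpow f n).
Proof.
elim: m => [|m IH] z /=; first by rewrite conv1f.
by rewrite (eq_conv (frefl _) IH) convA.
Qed.

Lemma cpowM f m n : cpow f (n * m) =1 cpow (cpow f m) n.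
Proof.
elim: n => [|n IH] z //=; rewrite mulSn cpowD.
by apply: eq_conv => // x; rewrite IH.
Qed.

Lemma eq_cpow f f' n : f =1 f' -> cpow f n =1 cpow f' n.
Proof. by move=> ef; elim: n => //= n IH; apply: eq_conv. Qed.

Lemma cpow1 f : cpow f 1 =1 f.
Proof.
move=> z; rewrite /= /conv (bigD1 z) //= mulVg eqxx mulr1 big1 ?addr0 // => a ne_az.
by rewrite -eq_invg_mul invgK (negbTE ne_az) mulr0.
Qed.

Lemma cpowE f n z :
  cpow f n z = iterE f n (fun s => ((\prod_(a <- s) a)%g == z)%:R).
Proof.
elim: n z => [|n IH] z /=; first by rewrite big_nil eq_sym.
apply: eq_bigr => a _; rewrite IH; congr (_ * _); apply: eq_iterE => s _.
by rewrite big_cons -(inj_eq (mulgI a)) mulKVg.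
Qed.
End Convolution.

(** * Distance to uniformity and its behaviour under convolution *)

Section NearUniform.
Variables (R : realFieldType) (gT : finGroupType).
Implicit Types (f g : gT -> R) (d e : R).

Definition distr (T : finType) (f : T -> R) :=
  (forall z, 0 <= f z) /\ \sum_z f z = 1.

(** Relative distance in the sup norm: this is what goodness asks for, and it is submultiplicative
    under convolution. *)
Definition near_unif (T : finType) d (f : T -> R) :=
  forall z, `|#|T|%:R * f z - 1| <= d.

Lemma distr_conv f g : distr f -> distr g -> distr (conv f g).
Proof.
move=> [f0 f1] [g0 g1]; split=> [z|].
  by apply: sumr_ge0 => a _; rewrite mulr_ge0.
rewrite /conv exchange_big /= -[RHS]f1; apply: eq_bigr => a _.
rewrite -big_distrr /= (reindex_inj (mulgI a)) /=.
by under eq_bigr do rewrite mulKg; rewrite g1 mulr1.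
Qed.

Lemma distr_delta : distr (fun z : gT => (z == 1%g)%:R : R).
Proof.
split=> [z|]; first by rewrite ler0n.
by have := sum_delta (fun=> 1 : R) (1%g : gT); under eq_bigr do rewrite mulr1.
Qed.

Lemma distr_cpow f n : distr f -> distr (cpow f n).
Proof.
move=> df; elim: n => [|n IH] /=; first exact: distr_delta.
exact: distr_conv.
Qed.

Lemma sum_shift g z : \sum_a g (a^-1 * z)%g = \sum_a g a.
Proof.
rewrite [RHS](reindex (fun a => a^-1 * z)%g) //=.
exists (fun a => z * a^-1)%g => a _ /=.
  by rewrite invMg invgK mulKVg.
by rewrite invMg invgK mulgKV.
Qed.

(** The deviations from 1 have mean zero, so the cross terms vanish and the deviation of the
    convolution is the average of the products of deviations. *)
Lemma near_unif_conv d e f g : distr f -> distr g ->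
  near_unif d f -> near_unif e g -> near_unif (d * e) (conv f g).
Proof.
move=> [_ f1] [_ g1] df eg z; set N := #|gT|%:R : R.
have N0 : 0 < N by apply: card_fin_gt0 (1%g : gT).
have -> : N * conv f g z - 1 =
    N^-1 * \sum_a (N * f a - 1) * (N * g (a^-1 * z)%g - 1).
  under eq_bigr do rewrite mulrBl mulrBr mul1r mulr1.
  have sN : \sum_(a : gT) (1 : R) = N by rewrite sumr_const.
  rewrite !sumrB sN -!big_distrr /= sum_shift f1 g1 /conv.
  have -> : \sum_a N * f a * (N * g (a^-1 * z)%g) =
      N * N * \sum_a f a * g (a^-1 * z)%g.
    by rewrite big_distrr /=; apply: eq_bigr => a _; ring.
  by field; rewrite gt_eqF.
rewrite normrM ger0_norm ?invr_ge0 ?(ltW N0) // ler_pdivrMl //.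
apply: le_trans (ler_norm_sum _ _ _) _.
apply: (@le_trans _ _ (\sum_(a : gT) d * e)); last first.
  by rewrite sumr_const -mulr_natl.
apply: ler_sum => a _; rewrite normrM; apply: ler_pM => //.
Qed.

Lemma near_unif_conv_distr e f g : distr f -> near_unif e g ->
  near_unif e (conv f g).
Proof.
move=> [f0 f1] eg z; set N := #|gT|%:R : R.
have -> : N * conv f g z - 1 = \sum_a f a * (N * g (a^-1 * z)%g - 1).
  under eq_bigr do rewrite mulrBr mulr1.
  rewrite sumrB f1 /conv big_distrr /=; congr (_ - _).
  by apply: eq_bigr => a _; ring.
apply: le_trans (ler_norm_sum _ _ _) _.
rewrite -[leRHS]mul1r -[X in _ <= X * _]f1 big_distrl /=; apply: ler_sum => a _.
by rewrite normrM ger0_norm // ler_wpM2l //; apply: eg.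
Qed.

Lemma near_unif_cpow d f n : (0 < n)%N -> distr f -> near_unif d f ->
  near_unif (d ^+ n) (cpow f n).
Proof.
move=> n0 df nf; case: n n0 => // n _; elim: n => [|n IH].
  by move=> z; rewrite cpow1 expr1.
rewrite exprS; apply: near_unif_conv => //; exact: (distr_cpow n.+1 df).
Qed.

Lemma near_unif_cpow_add d f m n : distr f -> near_unif d (cpow f n) ->
  near_unif d (cpow f (m + n)).
Proof.
move=> df nf z; rewrite cpowD; apply: near_unif_conv_distr => //.
exact: distr_cpow.
Qed.

Lemma eq_near_unif d f g : f =1 g -> near_unif d f -> near_unif d g.
Proof. by move=> efg nf z; rewrite -efg. Qed.

Lemma near_unif_le d e f : d <= e -> near_unif d f -> near_unif e f.
Proof. by move=> de nf z; apply: le_trans (nf z) de. Qed.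

Lemma eq_mulg_move (a h z : gT) : (a * h == z)%g = (h == a^-1 * z)%g.
Proof. by rewrite -(inj_eq (mulgI a^-1%g)) mulKg. Qed.

Lemma eq_mulg_move_sym (a h z : gT) : (h == a * z)%g = (a^-1 * h == z)%g.
Proof. by rewrite -(inj_eq (mulgI a^-1%g)) mulKg. Qed.

Lemma near_unif_ge0 d f : near_unif d f -> 0 <= d.
Proof. by move=> nf; apply: le_trans (nf 1%g). Qed.

End NearUniform.

(** * The inductive step: second moments and collisions *)

Section InterleavedStep.
Variables (R : realFieldType) (gT : finType) (x0 : gT) (hT : finGroupType).
Variable D : gT -> hT.
Implicit Types (x : seq gT) (A : seq hT).

Definition interl x A : hT := (\prod_(p <- zip x A) (D p.1 * p.2))%g.

Definition collision n : R :=
  iterE (@unif R gT) n (fun x => iterE (@unif R gT) n (fun x' =>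
    iterE (@unif R hT) n (fun A => (interl x A == interl x' A)%:R))).

Lemma interl_cons x y A a : interl (y :: x) (a :: A) = (D y * a * interl x A)%g.
Proof. by rewrite /interl /= big_cons. Qed.

(** For fixed [c] each letter undergoes a bijection that preserves its weight. Averaging over [c]
    afterwards inserts independent uniform diagonal factors into the two coordinates. *)
Lemma iterE_translate (w : hT * hT -> R) n (c : seq (gT * gT)) F :
  (forall u v a b, w (D u * a, D v * b)%g = w (a, b)) -> size c = n ->
  iterE w n F = iterE w n (fun s => F
    [seq (D p.1.1 * p.2.1, D p.1.2 * p.2.2)%g | p <- zip c s]).
Proof.
move=> winv; elim: n c F => [|n IH] [|[u v] c] F //= [sz_c].
pose act (p : hT * hT) := (D u * p.1, D v * p.2)%g.
have act_inj : injective act.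
  by move=> [a b] [a' b'] [/mulgI -> /mulgI ->].
rewrite (reindex_inj act_inj) /=; apply: eq_bigr => -[a b] _.
by rewrite winv (IH c) //; congr (_ * _); apply: eq_iterE.
Qed.

Definition avg_interl n A z : R :=
  iterE (@unif R gT) n (fun x => (interl x A == z)%:R).

(* Given the letters, the two coordinates become independent. *)
Lemma cpow_avg_interl (w : hT * hT -> R) n z :
  (forall u v a b, w (D u * a, D v * b)%g = w (a, b)) ->
  cpow w n z = iterE w n (fun s =>
    avg_interl n (map fst s) z.1 * avg_interl n (map snd s) z.2).
Proof.
move=> winv; rewrite cpowE.
rewrite -[LHS](iterE_const n _ (sum_unif _ (x0, x0))).
under eq_iterE => c sz_c do rewrite (iterE_translate _ winv sz_c).
rewrite iterE_exchange; apply: eq_iterE => s sz_s.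
rewrite /avg_interl -iterE_unif_pair; apply: eq_iterE => c sz_c.
rewrite -natrM mulnb; congr (_%:R); congr nat_of_bool.
elim: n c s {w winv} sz_c sz_s z => [|n IH] [|[u v] c] [|[a b] s] //=.
  by move=> _ _ [z z']; rewrite /interl !big_nil.
move=> [sz_c] [sz_s] [z z'] /=; rewrite !interl_cons big_cons (@eq_mulg_move (hT * hT)%type).
by rewrite (IH c s sz_c sz_s) /= !eq_mulg_move.
Qed.

(** Conditioned on all the other letters, the last one alone makes the product near uniform; hence
    the error is [d] whatever the length. *)
Lemma near_unif_interl d (w : hT -> R) n x z : distr w -> near_unif d w ->
  size x = n.+1 ->
  `|#|hT|%:R * iterE w n.+1 (fun A => (interl x A == z)%:R) - 1| <= d.
Proof.
move=> [w0 w1] nw; elim: n x z => [|n IH] [|y x] z // [sz_x].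
  case: x sz_x => // _ /=; under eq_bigr do rewrite interl_cons /interl big_nil mulg1.
  under eq_bigr do rewrite eq_mulg_move mulrC.
  by rewrite sum_delta.
set N := #|hT|%:R : R.
rewrite iterES (eq_bigr (fun a => w a * iterE w n.+1
    (fun A => (interl x A == (D y * a)^-1 * z)%g%:R))); last first.
  move=> a _; congr (_ * _); apply: eq_iterE => A _.
  by rewrite interl_cons eq_mulg_move.
set E := (E in N * E); have -> : N * E - 1 = \sum_a w a *
  (N * iterE w n.+1 (fun A => (interl x A == (D y * a)^-1 * z)%g%:R) - 1).
  under [RHS]eq_bigr do rewrite mulrBr mulr1.
  rewrite sumrB w1; congr (_ - _); rewrite /E big_distrr /=.
  by apply: eq_bigr => a _; rewrite mulrCA.
apply: le_trans (ler_norm_sum _ _ _) _.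
rewrite -[leRHS]mul1r -[X in _ <= X * _]w1 big_distrl /=; apply: ler_sum => a _.
by rewrite normrM ger0_norm // ler_wpM2l //; apply: IH.
Qed.

Lemma near_unif_avg_interl d (w : hT -> R) n z : distr w -> near_unif d w ->
  (0 < n)%N -> `|#|hT|%:R * iterE w n (fun A => avg_interl n A z) - 1| <= d.
Proof.
move=> dw nw; case: n => // n _; rewrite /avg_interl iterE_exchange.
set N := #|hT|%:R : R; set u := @unif R gT.
have u1 : \sum_a u a = 1 by apply: sum_unif x0.
set E := (E in N * E); have -> : N * E - 1 = iterE u n.+1 (fun x =>
    N * iterE w n.+1 (fun A => (interl x A == z)%:R) - 1).
  by rewrite iterED iterEZ iterE_const.
have key x : size x = n.+1 ->
    `|N * iterE w n.+1 (fun A => (interl x A == z)%:R) - 1| <= d.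
  by move=> sz_x; apply: near_unif_interl.
rewrite ler_norml; apply/andP; split.
  rewrite -[X in X <= _](iterE_const n.+1 _ u1); apply: iterE_le.
    exact: unif_ge0.
  by move=> x /key; rewrite ler_norml => /andP[].
rewrite -[X in _ <= X](iterE_const n.+1 _ u1); apply: iterE_le.
  exact: unif_ge0.
by move=> x /key; rewrite ler_norml => /andP[].
Qed.

(* Right translation of the last letter makes every common value equally likely. *)
Lemma joint_interl_shift n x x' z z' g : size x = n.+1 -> size x' = n.+1 ->
  iterE (@unif R hT) n.+1
    (fun A => (interl x A == z * g)%g%:R * (interl x' A == z' * g)%g%:R) =
  iterE (@unif R hT) n.+1
    (fun A => (interl x A == z)%:R * (interl x' A == z')%:R).
Proof.
elim: n x x' z z' => [|n IH] [|y x] [|y' x'] z z' // [sz_x] [sz_x'].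
  case: x x' sz_x sz_x' => // -[] // _ _ /=.
  rewrite (reindex_inj (mulIg g)) /=; apply: eq_bigr => a _.
  rewrite /interl /= !big_cons !big_nil /= !mulg1 !mulgA.
  by rewrite !(inj_eq (mulIg g)).
rewrite !(iterES _ n.+1); apply: eq_bigr => a _; congr (_ * _).
under eq_iterE do rewrite !interl_cons !eq_mulg_move !mulgA.
rewrite IH //.
by under [RHS]eq_iterE do rewrite !interl_cons !eq_mulg_move.
Qed.

(** All common values are equally likely, so the coincidence event, their disjoint union, has
    [#|hT|] times the probability of each. *)
Lemma joint_interl n x x' z : size x = n.+1 -> size x' = n.+1 ->
  #|hT|%:R * iterE (@unif R hT) n.+1
    (fun A => (interl x A == z)%:R * (interl x' A == z)%:R) =
  iterE (@unif R hT) n.+1 (fun A => (interl x A == interl x' A)%:R).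
Proof.
move=> sz_x sz_x'.
transitivity (\sum_(g : hT) iterE (@unif R hT) n.+1
    (fun A => (interl x A == g)%:R * (interl x' A == g)%:R)).
  rewrite mulr_natl -sumr_const; apply: eq_big => // g _.
  by rewrite -[RHS](@joint_interl_shift n x x' g g (g^-1 * z)%g) // mulKVg.
rewrite -iterE_sum; apply: eq_iterE => A _.
under eq_bigr do rewrite eq_sym.
by rewrite (sum_delta (fun g => (interl x' A == g)%:R)) eq_sym.
Qed.

(** Expanding the square produces two independent sequences [x] and [x'] run on the same letters.
    Only here are the letters replaced by uniform ones. *)
Lemma second_moment_interl d (w : hT -> R) n z : distr w -> near_unif d w ->
  (0 < n)%N ->
  iterE w n (fun A => (#|hT|%:R * avg_interl n A z) ^+ 2) <=
  (1 + d) ^+ n * (#|hT|%:R * collision n).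
Proof.
move=> [w0 w1] nw; case: n => // n _; set N := #|hT|%:R : R.
have d0 : 0 <= d := near_unif_ge0 nw.
have N0 : 0 < N := card_fin_gt0 _ (1%g : hT).
apply: (@le_trans _ _ ((1 + d) ^+ n.+1 * iterE (@unif R hT) n.+1
  (fun A => (N * avg_interl n.+1 A z) ^+ 2))).
  apply: iterE_dominated => //; first exact: addr_ge0.
  - exact: unif_ge0.
  - move=> a; rewrite /unif -/N ler_pdivlMr // mulrC.
    by have := nw a; rewrite ler_norml => /andP[_]; rewrite lerBlDl.
  - by move=> s; rewrite sqr_ge0.
rewrite ler_wpM2l ?exprn_ge0 ?addr_ge0 //.
have -> : iterE (@unif R hT) n.+1 (fun A => (N * avg_interl n.+1 A z) ^+ 2) =
   N * iterE (@unif R hT) n.+1 (fun A => iterE (@unif R gT) n.+1 (fun x =>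
     iterE (@unif R gT) n.+1 (fun x' => N * ((interl x A == z)%:R *
      (interl x' A == z)%:R)))).
  rewrite -iterEZ; apply: eq_iterE => A _.
  rewrite /avg_interl exprMn !expr2 -mulrA; congr (_ * _).
  rewrite mulrA -[N * iterE _ _ _]iterEZ -iterEZr; apply: eq_iterE => x _.
  by rewrite -iterEZ; apply: eq_iterE => x' _; ring.
rewrite (ler_wpM2l (ltW N0)) // /collision le_eqVlt; apply/orP; left; apply/eqP.
rewrite [LHS]iterE_exchange; apply: eq_iterE => x sz_x.
rewrite [LHS]iterE_exchange; apply: eq_iterE => x' sz_x'.
by rewrite iterEZ joint_interl.
Qed.

Lemma near_unif_step d (w : hT * hT -> R) n : distr w ->
  (forall u v a b, w (D u * a, D v * b)%g = w (a, b)) ->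
  near_unif d (pushw fst w) -> near_unif d (pushw snd w) -> (0 < n)%N ->
  near_unif ((1 + d) ^+ n * (#|hT|%:R * collision n) - 1 + 4 * d) (cpow w n).
Proof.
move=> [w0 w1] winv n1 n2 npos z; set N := #|hT|%:R : R.
have dpush (f : hT * hT -> hT) : distr (pushw f w).
  split=> [a|]; first by apply: sumr_ge0.
  rewrite -[RHS]w1; under eq_bigr do rewrite -[pushw f w _]mulr1.
  by rewrite sum_pushw; under eq_bigr do rewrite mulr1.
rewrite cpow_avg_interl // card_prod natrM -/N.
set Q := _ * (N * _).
pose u (s : seq (hT * hT)) := N * avg_interl n (map fst s) z.1.
pose v (s : seq (hT * hT)) := N * avg_interl n (map snd s) z.2.
have E1 : `|iterE w n u - 1| <= d.
  by rewrite iterEZ (iterE_push _ _ _ (fun A => avg_interl n A z.1)) near_unif_avg_interl.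
have E2 : `|iterE w n v - 1| <= d.
  by rewrite iterEZ (iterE_push _ _ _ (fun A => avg_interl n A z.2)) near_unif_avg_interl.
have E3 : iterE w n (fun s => u s ^+ 2) <= Q.
  rewrite (iterE_push _ _ _ (fun A => (N * avg_interl n A z.1) ^+ 2)).
  exact: second_moment_interl.
have E4 : iterE w n (fun s => v s ^+ 2) <= Q.
  rewrite (iterE_push _ _ _ (fun A => (N * avg_interl n A z.2) ^+ 2)).
  exact: second_moment_interl.
have -> : N * N * iterE w n (fun s => avg_interl n (map fst s) z.1 *
    avg_interl n (map snd s) z.2) = iterE w n (fun s => u s * v s).
  by rewrite -iterEZ; apply: eq_iterE => s _; rewrite /u /v; ring.
move: E1 E2; rewrite !ler_norml => /andP[E1l E1u] /andP[E2l E2u].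
have up : iterE w n (fun s => u s * v s) <=
    2^-1 * iterE w n (fun s => u s ^+ 2) + 2^-1 * iterE w n (fun s => v s ^+ 2).
  rewrite -!iterEZ -iterED; apply: iterE_le => // s _.
  by have := sqr_ge0 (u s - v s); lra.
(* The lower bound comes from [(u + v - 2)^2 >= 0]. The means of [u] and [v] enter with coefficient
   2 each, and both may be off by [d]: this is the term [4 * d]. *)
have lo : 2 * iterE w n u + 2 * iterE w n v +
    - 2^-1 * iterE w n (fun s => u s ^+ 2) + - 2^-1 * iterE w n (fun s => v s ^+ 2)
    + - 2 <= iterE w n (fun s => u s * v s).
  rewrite -[X in _ + X <= _](iterE_const n (- 2) w1) -!iterEZ -!iterED.
  apply: iterE_le => // s _.
  by have := sqr_ge0 (u s + v s - 2); lra.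
apply/andP; split; lra.
Qed.

End InterleavedStep.

(** * Collisions and conjugacy walks *)

Section Tower.
Variables (R : realFieldType) (gT : finGroupType).

(* The group [G^({0,1}^k)]; the outermost pair is indexed by the first bit. *)
Fixpoint tower k : finGroupType :=
  if k is k'.+1 then (tower k' * tower k')%type else gT.

Fixpoint diag k : gT -> tower k :=
  if k is k'.+1 then fun g => (diag k' g, diag k' g) else id.

Lemma card_tower k : #|tower k| = (#|gT| ^ expn 2 k)%N.
Proof.
elim: k => [|k IH]; first by rewrite expn0 expn1.
by rewrite /= card_prod IH -expnD expnS mul2n addnn.
Qed.

Lemma interl_pair (xT : finType) (h1 h2 : finGroupType) (D1 : xT -> h1)
    (D2 : xT -> h2) x (A : seq (h1 * h2)) :
  interl (fun u => (D1 u, D2 u)) x A =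
  (interl D1 x (map fst A), interl D2 x (map snd A)).
Proof.
elim: x A => [|y x IH] [|[a b] A]; rewrite /interl /= ?big_nil //.
by move: (IH A); rewrite /interl !big_cons /= => ->.
Qed.

Definition coincidence (h : finGroupType) (D : gT -> h) n x x' : R :=
  iterE (@unif R h) n (fun A => (interl D x A == interl D x' A)%:R).

(** Uniform letters of a product group have independent uniform coordinates, and the diagonal gives
    both halves of the cube the same [x] and [x']. *)
Lemma coincidence_tower k n x x' :
  coincidence (diag k) n x x' = coincidence id n x x' ^+ expn 2 k.
Proof.
elim: k => [|k IH]; first by rewrite expn0 expr1.
rewrite expnS mul2n -addnn exprD -IH /coincidence -iterE_unif_pair.
apply: eq_iterE => A _; rewrite !(@interl_pair gT _ _ (diag k) (diag k)).
by rewrite -natrM mulnb.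
Qed.

End Tower.

(** * Products of random conjugates and their contraction in mean square *)

Section ConjugacyWalk.
Variables (R : realFieldType) (gT : finGroupType).
Implicit Types (y z g h : gT) (phi : gT -> R).

Local Notation N := (#|gT|%:R : R).

Definition conj_avg y phi z : R := N^-1 * \sum_h phi (z * y ^ h)%g.

(** The probability that [z y_1^{h_1} ... y_n^{h_n} = 1] for independent uniform [h_j]. *)
Fixpoint conj_walk (ys : seq gT) : gT -> R :=
  if ys is y :: ys' then conj_avg y (conj_walk ys') else fun z => (z == 1%g)%:R.

Let N0 : 0 < N. Proof. exact: card_fin_gt0 (1%g : gT). Qed.
Let Nn0 : N != 0. Proof. exact: lt0r_neq0. Qed.

Lemma conj_walkJ ys z g : conj_walk ys (z ^ g)%g = conj_walk ys z.
Proof.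
elim: ys z => [|y ys IH] z /=; first by rewrite conjg_eq1.
congr (_ * _); rewrite (reindex_inj (mulIg g)) /=.
by apply: eq_bigr => h _; rewrite conjgM -conjMg IH.
Qed.

Lemma sum_mulg z phi : \sum_w phi (z * w)%g = \sum_w phi w.
Proof. by rewrite [RHS](reindex_inj (mulgI z)). Qed.

Lemma sum_constN (c : R) : \sum_(h : gT) c = N * c.
Proof. by rewrite sumr_const mulr_natl. Qed.

Lemma sumr_avg (c : R) : N^-1 * \sum_(h : gT) c = c.
Proof. by rewrite sum_constN mulrA mulVf // mul1r. Qed.

Lemma sum_conj_avg y phi : \sum_z conj_avg y phi z = \sum_z phi z.
Proof.
rewrite -big_distrr /= exchange_big /= -[RHS]sumr_avg; congr (_ * _).
by apply: eq_bigr => h _; rewrite [RHS](reindex_inj (mulIg (y ^ h)%g)).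
Qed.

Lemma sum_conj_walk ys : \sum_z conj_walk ys z = 1.
Proof.
elim: ys => [|y ys IH] /=; last by rewrite sum_conj_avg.
exact: (distr_delta R gT).2.
Qed.

Lemma conj_avg_shift y phi c z :
  conj_avg y (fun w => phi w - c) z = conj_avg y phi z - c.
Proof. by rewrite /conj_avg sumrB mulrBr sumr_avg. Qed.

Lemma eq_conj_avg y phi phi' z : phi =1 phi' -> conj_avg y phi z = conj_avg y phi' z.
Proof. by move=> e; congr (_ * _); apply: eq_bigr. Qed.

Lemma cauchy_schwarz (I : finType) (a b : I -> R) :
  (\sum_i a i * b i) ^+ 2 <= (\sum_i a i ^+ 2) * \sum_i b i ^+ 2.
Proof.
have H : 0 <= \sum_i \sum_j (a i * b j - a j * b i) ^+ 2.
  by do 2!apply: sumr_ge0 => ? _; rewrite sqr_ge0.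
suff E : \sum_i \sum_j (a i * b j - a j * b i) ^+ 2 =
  2 * ((\sum_i a i ^+ 2) * (\sum_i b i ^+ 2)) - 2 * (\sum_i a i * b i) ^+ 2.
  by move: H; rewrite E; lra.
have -> : \sum_i \sum_j (a i * b j - a j * b i) ^+ 2 =
  \sum_i \sum_j (a i ^+ 2 * b j ^+ 2) + \sum_i \sum_j (a j ^+ 2 * b i ^+ 2) -
  2 * \sum_i \sum_j (a i * b i * (a j * b j)).
  rewrite !big_distrr -big_split -sumrB /=; apply: eq_bigr => i _.
  rewrite !big_distrr -big_split -sumrB /=; apply: eq_bigr => j _; ring.
rewrite [X in _ + X - _]exchange_big /= expr2 !big_distrlr /=; ring.
Qed.

Lemma conj_avg_contract y phi :
  \sum_z conj_avg y phi z ^+ 2 <= \sum_z phi z ^+ 2.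
Proof.
apply: (@le_trans _ _ (\sum_z N^-1 * \sum_h phi (z * y ^ h)%g ^+ 2)).
  apply: ler_sum => z _; rewrite /conj_avg exprMn.
  have := cauchy_schwarz (fun h => phi (z * y ^ h)%g) (fun=> 1).
  rewrite expr1n sum_constN mulr1; under eq_bigr do rewrite mulr1.
  move=> H; rewrite expr2 -mulrA ler_wpM2l ?invr_ge0 ?(ltW N0) //.
  by rewrite ler_pdivrMl // [leRHS]mulrC.
rewrite -big_distrr /= exchange_big /= -[leRHS]sumr_avg le_eqVlt.
apply/orP; left; apply/eqP; congr (_ * _); apply: eq_bigr => h _.
by rewrite [RHS](reindex_inj (mulIg (y ^ h)%g)).
Qed.

Definition pair_law y y' w : R :=
  N^-1 * (N^-1 * \sum_g \sum_h ((y ^ g * y' ^ h)%g == w)%:R).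

(** The chi-square distance of [pair_law] to the uniform law, equal to the squared Hilbert-Schmidt
    norm of convolution by its deviation from uniform (see [pair_energyE]). *)
Definition pair_energy y y' : R := N * \sum_w pair_law y y' w ^+ 2 - 1.

Lemma sum_pair_law_mul y y' (F : gT -> R) :
  \sum_w pair_law y y' w * F w =
  N^-1 * (N^-1 * \sum_g \sum_h F (y ^ g * y' ^ h)%g).
Proof.
rewrite (eq_bigr (fun w => N^-1 * (N^-1 *
    \sum_g \sum_h (w == y ^ g * y' ^ h)%g%:R * F w))); last first.
  move=> w _; rewrite /pair_law -!mulrA big_distrl /=; do 2!congr (_ * _).
  apply: eq_bigr => g _; rewrite big_distrl /=.
  by apply: eq_bigr => h _; rewrite eq_sym.
rewrite -!big_distrr /=; do 2!congr (_ * _).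
rewrite exchange_big /=; apply: eq_bigr => g _.
rewrite exchange_big /=; apply: eq_bigr => h _.
by rewrite sum_delta.
Qed.

Lemma sum_pair_law y y' : \sum_w pair_law y y' w = 1.
Proof.
under eq_bigr do rewrite -[pair_law _ _ _]mulr1.
by rewrite (sum_pair_law_mul y y' (fun=> 1)) !sum_constN mulr1 mulKf // mulVf.
Qed.

Lemma pair_energyE y y' :
  pair_energy y y' = N * \sum_w (pair_law y y' w - N^-1) ^+ 2.
Proof.
have -> : \sum_w (pair_law y y' w - N^-1) ^+ 2 =
  \sum_w pair_law y y' w ^+ 2 - 2 * N^-1 * \sum_w pair_law y y' w +
  \sum_(w : gT) N^-1 ^+ 2.
  rewrite big_distrr -sumrB -big_split /=; apply: eq_bigr => w _; ring.
rewrite sum_pair_law sum_constN /pair_energy.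
by field.
Qed.

Lemma pair_energy_ge0 y y' : 0 <= pair_energy y y'.
Proof.
rewrite pair_energyE mulr_ge0 ?(ltW N0) //.
by apply: sumr_ge0 => w _; rewrite sqr_ge0.
Qed.

(** On mean-zero functions the law can be replaced by its deviation from uniform; Cauchy-Schwarz at
    each point does the rest. *)
Lemma conj_avg2_contract y y' phi : \sum_z phi z = 0 ->
  \sum_z conj_avg y (conj_avg y' phi) z ^+ 2 <=
  pair_energy y y' * \sum_z phi z ^+ 2.
Proof.
move=> phi0.
have E z : conj_avg y (conj_avg y' phi) z =
    \sum_w (pair_law y y' w - N^-1) * phi (z * w)%g.
  under eq_bigr do rewrite mulrBl.
  rewrite sumrB -[X in _ - X]big_distrr /= sum_mulg phi0.
  rewrite mulr0 subr0 sum_pair_law_mul /conj_avg; congr (_ * _).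
  rewrite big_distrr /=; apply: eq_bigr => g _; congr (_ * _).
  apply: eq_bigr => h _; congr phi; exact: esym (mulgA _ _ _).
rewrite pair_energyE -mulrA -sum_constN.
apply: ler_sum => z _; rewrite E.
apply: le_trans (cauchy_schwarz _ _) _.
by rewrite (sum_mulg z (fun w => phi w ^+ 2)).
Qed.

Variable lam : gT -> gT -> R.
Hypothesis lam0 : forall y y', 0 <= lam y y'.
Hypothesis lam1 : forall y y', lam y y' <= 1.
Hypothesis lamP : forall y y' phi, \sum_z phi z = 0 ->
  \sum_z conj_avg y (conj_avg y' phi) z ^+ 2 <= lam y y' ^+ 2 * \sum_z phi z ^+ 2.

(** The pairs of consecutive letters are disjoint, so for independent letters the factors are
    independent and the mean is a power ([iterE_lam_prod]). *)
Fixpoint lam_prod (ys : seq gT) : R :=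
  if ys is y :: y' :: ys' then lam y y' * lam_prod ys' else 1.

Lemma lam_prod_ge0 n ys : size ys = n.*2 -> 0 <= lam_prod ys.
Proof.
by elim: n ys => [|n IH] [|y [|y' ys]] //= [sz]; rewrite mulr_ge0 ?IH.
Qed.

Lemma lam_prod_le1 n ys : size ys = n.*2 -> lam_prod ys <= 1.
Proof.
elim: n ys => [|n IH] [|y [|y' ys]] //= [sz].
by rewrite mulr_ile1 ?IH ?(lam_prod_ge0 sz).
Qed.

Lemma conj_walk_norm n ys : size ys = n.*2 ->
  \sum_z (conj_walk ys z - N^-1) ^+ 2 <= lam_prod ys ^+ 2.
Proof.
elim: n ys => [|n IH] [|y [|y' ys]] // => [_|[sz]].
  rewrite [leRHS]expr1n.
  apply: (@le_trans _ _ (\sum_(z : gT) ((z == 1%g)%:R * (1 - 2 * N^-1) + N^-1 ^+ 2))).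
    by apply: ler_sum => z _ /=; case: (z == 1%g) => /=; lra.
  rewrite big_split /= sum_delta sum_constN expr2 mulrA divff //.
  by have := invr_ge0 N; rewrite (ltW N0); lra.
rewrite [lam_prod _]/= exprMn.
have sz0 : \sum_z (conj_walk ys z - N^-1) = 0.
  by rewrite sumrB sum_conj_walk sum_constN divff // subrr.
apply: le_trans (ler_wpM2l (sqr_ge0 _) (IH _ sz)).
apply: le_trans (lamP _ _ sz0); rewrite le_eqVlt; apply/orP; left; apply/eqP.
apply: eq_bigr => z _; rewrite -conj_avg_shift; congr (_ ^+ 2).
by apply: eq_conj_avg => w; rewrite -conj_avg_shift.
Qed.

Lemma conj_walk1_le n ys : size ys = n.*2 ->
  N * conj_walk ys 1%g <= 1 + N * lam_prod ys.
Proof.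
move=> sz; have := conj_walk_norm sz; rewrite (bigD1 1%g) //= => H.
have {H} H : (conj_walk ys 1%g - N^-1) ^+ 2 <= lam_prod ys ^+ 2.
  apply: le_trans H; rewrite lerDl; apply: sumr_ge0 => z _; exact: sqr_ge0.
have L0 := lam_prod_ge0 sz.
have : `|conj_walk ys 1%g - N^-1| <= lam_prod ys.
  by rewrite -(ler_pXn2r (ltn0Sn 1)) ?nnegrE // real_normK // num_real.
rewrite ler_norml => /andP[_]; rewrite lerBlDr => H1.
have := ler_wpM2l (ltW N0) H1; rewrite mulrDr divff //; lra.
Qed.

(** Cancelling [x'_1 h_1] turns the equation into [(x'_1^-1 z^g x_1)^{h_1} * tail = tail'], so the
    first letter becomes the random conjugator of the shorter problem. The average over [g] gives
    the induction this shape; it disappears at [z = 1]. *)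
Lemma conj_walk_avg n (x x' : seq gT) z : size x = n -> size x' = n ->
  N^-1 * \sum_g iterE (@unif R gT) n
     (fun A => ((z ^ g * interl id x A)%g == interl id x' A)%:R) =
  conj_walk [seq p.1 * p.2^-1 | p <- zip x x']%g z.
Proof.
elim: n x x' z => [|n IH] [|y x] [|y' x'] z // => [_ _|[sz_x] [sz_x']].
  rewrite /= -[RHS]sumr_avg; congr (_ * _); apply: eq_bigr => g _.
  by rewrite /interl !big_nil mulg1 conjg_eq1.
rewrite [RHS]/= /conj_avg; congr (_ * _).
rewrite [RHS](reindex_inj invg_inj) /=; apply: eq_bigr => g _.
transitivity (conj_walk [seq p.1 * p.2^-1 | p <- zip x x']%g (y'^-1 * z ^ g * y)%g).
  rewrite -IH // big_distrr /=; apply: eq_bigr => h _; congr (_ * _).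
  apply: eq_iterE => A _; rewrite !interl_cons.
  have mvE (c t : gT) :
      ((y' * h)^-1 * (c * (y * h * t)) = (y'^-1 * c * y) ^ h * t)%g.
    by rewrite conjgE invMg !mulgA.
  by rewrite -mvE [in RHS]eq_sym -eq_mulg_move [in RHS]eq_sym.
rewrite -(conj_walkJ _ _ (y'^-1)%g) -[RHS](conj_walkJ _ _ g).
congr (conj_walk _ _); rewrite [RHS]conjMg -conjgM mulVg conjg1.
by rewrite !conjgE invgK !mulgA mulgV mul1g.
Qed.

Lemma coincidenceE n (x x' : seq gT) : size x = n -> size x' = n ->
  coincidence R id n x x' = conj_walk [seq p.1 * p.2^-1 | p <- zip x x']%g 1%g.
Proof.
move=> sx sx'; rewrite -(conj_walk_avg _ sx sx') -[LHS]sumr_avg; congr (_ * _).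
apply: eq_bigr => g _; apply: eq_iterE => A _.
by rewrite conj1g mul1g.
Qed.

Definition mean_lam : R := N^-1 * (N^-1 * \sum_y \sum_y' lam y y').

Lemma iterE_lam_prod n : iterE (@unif R gT) n.*2 lam_prod = mean_lam ^+ n.
Proof.
elim: n => [|n IH] //; rewrite doubleS !iterES exprS -IH.
rewrite /mean_lam big_distrr big_distrr big_distrl /=; apply: eq_bigr => y _.
rewrite big_distrr /= big_distrr /= big_distrr /= big_distrl /=.
by apply: eq_bigr => y' _; rewrite iterEZ /unif; ring.
Qed.

Lemma iterE_nested (T U : finType) (w : T -> R) (v : U -> R) n F :
  iterE w n (fun x => iterE v n (F x)) =
  iterE (fun c : T * U => w c.1 * v c.2) n (fun c => F (map fst c) (map snd c)).
Proof.
elim: n F => [|n IH] F //=.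
transitivity (\sum_a \sum_b w a * v b * iterE w n (fun s =>
   iterE v n (fun s' => F (a :: s) (b :: s')))).
  apply: eq_bigr => a _; rewrite iterE_sum big_distrr /=.
  by apply: eq_bigr => b _; rewrite iterEZ mulrA.
rewrite pair_bigA /=; apply: eq_bigr => -[a b] _ /=.
by rewrite (IH (fun s s' => F (a :: s) (b :: s'))).
Qed.

Lemma iterE_quotients n (F : seq gT -> R) :
  iterE (@unif R gT) n (fun x => iterE (@unif R gT) n (fun x' =>
    F [seq p.1 * p.2^-1 | p <- zip x x']%g)) = iterE (@unif R gT) n F.
Proof.
rewrite iterE_nested; under eq_iterE do rewrite zip_unzip.
rewrite (iterE_push (fun p : gT * gT => p.1 * p.2^-1)%g).
apply: eq_iterEw => y; rewrite /pushw.
transitivity (\sum_(a : gT) N^-1 * N^-1); last first.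
  by rewrite sum_constN mulrA divff // mul1r.
rewrite -(pair_big_dep predT (fun a b => (a * b^-1)%g == y)
  (fun a b => N^-1 * N^-1)) /=.
apply: eq_bigr => a _; rewrite (big_pred1 (y^-1 * a)%g) // => b.
by rewrite -(inj_eq (mulIg b)) mulgKV -(inj_eq (mulgI y^-1)%g) mulKg eq_sym.
Qed.

(** A convex function lies below its chord on the interval from 0 to 1. The bound being linear in
    [l], the mean of a [2^k]-th power reduces to the mean of [lam_prod]. *)
Lemma expr1D_convex (c l : R) m : 0 <= c -> 0 <= l <= 1 ->
  (1 + c * l) ^+ m <= 1 + (1 + c) ^+ m * l.
Proof.
move=> c0 /andP[l0 l1].
suff : (1 + c * l) ^+ m <= 1 + ((1 + c) ^+ m - 1) * l by lra.
elim: m => [|m IH]; first by rewrite !expr0 subrr mul0r addr0.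
rewrite !exprS.
have c1 : 1 <= (1 + c) ^+ m by rewrite exprn_ege1 // lerDl.
have p0 : 0 <= 1 + c * l by rewrite addr_ge0 // mulr_ge0.
apply: le_trans (ler_wpM2l p0 IH) _.
set a := (1 + c) ^+ m in c1 *.
have : 0 <= c * (a - 1) * (l * (1 - l)).
  by rewrite !mulr_ge0 // subr_ge0.
by lra.
Qed.

Lemma tower_collision k n :
  #|tower gT k|%:R * collision R (@diag gT k) n.*2 <=
  1 + (1 + N) ^+ expn 2 k * mean_lam ^+ n.
Proof.
have -> : #|tower gT k|%:R = N ^+ expn 2 k by rewrite card_tower natrX.
rewrite -iterE_lam_prod -iterE_quotients /collision -!iterEZ.
set c := (1 + N) ^+ expn 2 k; set u := @unif R gT.
have u1 : \sum_a u a = 1 := sum_unif _ (1%g : gT).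
have -> : 1 + iterE u n.*2 (fun x => c * iterE u n.*2 (fun x' =>
      lam_prod [seq p.1 * p.2^-1 | p <- zip x x']%g)) =
    iterE u n.*2 (fun x => iterE u n.*2 (fun x' =>
      1 + c * lam_prod [seq p.1 * p.2^-1 | p <- zip x x']%g)).
  under [RHS]eq_iterE do rewrite iterED iterE_const // iterEZ.
  by rewrite iterED iterE_const.
apply: iterE_le; first exact: unif_ge0.
move=> x sz_x; rewrite -!iterEZ; apply: iterE_le; first exact: unif_ge0.
move=> x' sz_x'; rewrite -/(coincidence _ _ _ _ _) coincidence_tower.
rewrite -exprMn (coincidenceE sz_x sz_x').
set ys := [seq _ | _ <- _].
have sz : size ys = n.*2 by rewrite size_map size_zip sz_x sz_x' minnn.
have w0 : 0 <= N * conj_walk ys 1%g.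
  rewrite -(coincidenceE sz_x sz_x') mulr_ge0 ?(ltW N0) //.
  by apply: iterE_ge0 => [|s]; [exact: unif_ge0 | exact: ler0n].
apply: (@le_trans _ _ ((1 + N * lam_prod ys) ^+ expn 2 k)); last first.
  by apply: expr1D_convex; rewrite ?(ltW N0) // (lam_prod_ge0 sz) (lam_prod_le1 sz).
have le_w := conj_walk1_le sz.
by apply: lerXn2r; rewrite ?nnegrE // (le_trans w0).
Qed.

End ConjugacyWalk.

(** * From commutator counts to the average energy of a pair *)

Section CommutatorEnergy.
Variables (R : realFieldType) (gT : finGroupType) (good : pred gT).
Implicit Types (y z g h : gT).

Local Notation N := (#|gT|%:R : R).

Let N0 : 0 < N. Proof. exact: card_fin_gt0 (1%g : gT). Qed.
Let Nn0 : N != 0. Proof. exact: lt0r_neq0. Qed.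

(** The number of solutions of [[a, b] = z] with [a] good, since [a^b = a z] says that
    [a^-1 b^-1 a b = z]. *)
Definition comm_count z : R :=
  \sum_a \sum_b (good a)%:R * ((a ^ b)%g == (a * z)%g)%:R.

Variables (eps K beta : R).
Hypothesis eps0 : 0 <= eps.
Hypothesis K0 : 0 <= K.
Hypothesis beta1 : beta <= 1.
Hypothesis comm_le : forall z, z != 1%g -> comm_count z <= (1 + eps) * N.
Hypothesis comm1_le : comm_count 1%g <= K * N.
Hypothesis good_ge : (1 - beta) * N <= \sum_a (good a)%:R.

Let Al z : R := \sum_y \sum_g \sum_h (good y)%:R * (((y ^ g)^-1 * y ^ h)%g == z)%:R.
Let Ar z : R := \sum_y \sum_g \sum_h (good y)%:R * ((y ^ g * (y ^ h)^-1)%g == z)%:R.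

Lemma left_quotientsE z : Al z = \sum_g comm_count (z ^ g^-1)%g.
Proof.
rewrite /Al /comm_count exchange_big /=; apply: eq_bigr => g _.
apply: eq_bigr => y _; rewrite (reindex_inj (mulIg g)) /=.
apply: eq_bigr => h _; congr (_ * (nat_of_bool _)%:R).
by rewrite -eq_mulg_move_sym -[RHS](inj_eq (conjg_inj g)) (conjMg y) conjgKV conjgM.
Qed.

Lemma left_quotients_le z : z != 1%g -> Al z <= N * ((1 + eps) * N).
Proof.
move=> z1; rewrite left_quotientsE -[N * _](sum_constN gT).
by apply: ler_sum => g _; rewrite comm_le // conjg_eq1.
Qed.

Lemma left_quotients1_le : Al 1%g <= N * (K * N).
Proof.
rewrite left_quotientsE -[N * _](sum_constN gT).
by apply: ler_sum => g _; rewrite conj1g.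
Qed.

Lemma right_quotients1 : Ar 1%g = Al 1%g.
Proof.
do 3!(apply: eq_bigr => ? _); congr (_ * (nat_of_bool _)%:R).
by rewrite -eq_mulgV1 -eq_invg_mul invgK.
Qed.

Lemma right_quotients_ge0 z : 0 <= Ar z.
Proof. by do 3!(apply: sumr_ge0 => ? _); rewrite mulr_ge0 ?ler0n. Qed.

Lemma left_quotients_ge0 z : 0 <= Al z.
Proof. by do 3!(apply: sumr_ge0 => ? _); rewrite mulr_ge0 ?ler0n. Qed.

Lemma sum_right_quotients : \sum_z Ar z <= N * (N * N).
Proof.
have -> : \sum_z Ar z = \sum_y \sum_(g : gT) \sum_(h : gT) (good y)%:R.
  rewrite exchange_big /=; apply: eq_bigr => y _.
  rewrite exchange_big /=; apply: eq_bigr => g _.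
  rewrite exchange_big /=; apply: eq_bigr => h _.
  rewrite -big_distrr /= (eq_bigr (fun z => (z == y ^ g * (y ^ h)^-1)%g%:R * 1)).
    by rewrite sum_delta mulr1.
  by move=> z _; rewrite mulr1 eq_sym.
rewrite -[N * (N * N)](sum_constN gT); apply: ler_sum => y _.
by rewrite !sum_constN !ler_wpM2l ?(ltW N0) // ler_piMr ?(ltW N0) // lern1 leq_b1.
Qed.

(** Away from 1, [Al] is bounded pointwise and [Ar] only through its total mass. At 1 both are
    large, but this is a single term. *)
Lemma sum_quotients_le :
  \sum_z Al z * Ar z <= N ^+ 5 * (1 + eps) + N ^+ 4 * K ^+ 2.
Proof.
rewrite (bigD1 1%g) //= addrC right_quotients1; apply: lerD.
  apply: (@le_trans _ _ (\sum_(z | z != 1%g) N * ((1 + eps) * N) * Ar z)).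
    by apply: ler_sum => z z1; rewrite ler_wpM2r ?right_quotients_ge0 ?left_quotients_le.
  rewrite -big_distrr /=.
  have -> : N ^+ 5 * (1 + eps) = N * ((1 + eps) * N) * (N * (N * N)) by ring.
  rewrite ler_wpM2l ?mulr_ge0 ?addr_ge0 ?(ltW N0) //.
  apply: le_trans sum_right_quotients.
  by rewrite [leRHS](bigD1 1%g) //= lerDr right_quotients_ge0.
have -> : N ^+ 4 * K ^+ 2 = (N * (K * N)) ^+ 2 by ring.
rewrite -expr2; apply: lerXn2r; rewrite ?nnegrE ?left_quotients_ge0 //.
  by rewrite !mulr_ge0 ?(ltW N0).
exact: left_quotients1_le.
Qed.

Lemma sum_sqr_pair_law y y' : \sum_w pair_law R y y' w ^+ 2 =
  N^-1 ^+ 4 * \sum_g \sum_h \sum_g' \sum_h'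
    ((y ^ g' * y' ^ h')%g == (y ^ g * y' ^ h)%g)%:R.
Proof.
under eq_bigr do rewrite expr2.
rewrite sum_pair_law_mul /pair_law.
rewrite (eq_bigr (fun g => N^-1 ^+ 2 * \sum_h \sum_g' \sum_h'
    ((y ^ g' * y' ^ h')%g == (y ^ g * y' ^ h)%g)%:R)); last first.
  move=> g _; rewrite big_distrr /=; apply: eq_bigr => h _.
  by rewrite expr2 mulrA.
by rewrite -big_distrr /=; ring.
Qed.

(** The equation [y^g' y'^h' = y^g y'^h] separates into [(y^g)^-1 y^g' = y'^h (y'^h')^-1], with [y]
    on one side and [y'] on the other; [z] is the common value. *)
Lemma sum_good_sqr_pair_law :
  \sum_y \sum_y' (good y)%:R * (good y')%:R * \sum_w pair_law R y y' w ^+ 2 =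
  N^-1 ^+ 4 * \sum_z Al z * Ar z.
Proof.
transitivity (N^-1 ^+ 4 * \sum_y \sum_y' \sum_g \sum_h \sum_g' \sum_h' \sum_z
   ((good y)%:R * (((y ^ g)^-1 * y ^ g')%g == z)%:R) *
   ((good y')%:R * ((y' ^ h * (y' ^ h')^-1)%g == z)%:R)).
  rewrite big_distrr; apply: eq_bigr => y _ /=.
  rewrite big_distrr; apply: eq_bigr => y' _ /=.
  rewrite sum_sqr_pair_law mulrCA; congr (_ * _).
  rewrite big_distrr; apply: eq_bigr => g _ /=.
  rewrite big_distrr; apply: eq_bigr => h _ /=.
  rewrite big_distrr; apply: eq_bigr => g' _ /=.
  rewrite big_distrr; apply: eq_bigr => h' _ /=.
  rewrite (eq_bigr (fun z => (z == y' ^ h * (y' ^ h')^-1)%g%:R *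
    ((good y)%:R * (good y')%:R * (((y ^ g)^-1 * y ^ g')%g == z)%:R))); last first.
    by move=> z _; rewrite (eq_sym z); ring.
  rewrite sum_delta; congr (_ * (nat_of_bool _)%:R).
  rewrite -[RHS](inj_eq (mulIg (y' ^ h')%g)) mulgKV [LHS]eq_mulg_move_sym.
  by congr (_ == _); exact: mulgA.
congr (_ * _); rewrite /Al /Ar.
rewrite [RHS](eq_bigr (fun z => \sum_y \sum_y' \sum_g \sum_h \sum_g' \sum_h'
   ((good y)%:R * (((y ^ g)^-1 * y ^ g')%g == z)%:R) *
   ((good y')%:R * ((y' ^ h * (y' ^ h')^-1)%g == z)%:R))); last first.
  move=> z _; rewrite big_distrlr /=; apply: eq_bigr => y _; apply: eq_bigr => y' _.
  rewrite big_distrlr /=; apply: eq_bigr => g _; apply: eq_bigr => h _.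
  by rewrite big_distrlr.
rewrite [RHS]exchange_big; apply: eq_bigr => y _ /=.
rewrite [RHS]exchange_big; apply: eq_bigr => y' _ /=.
rewrite [RHS]exchange_big; apply: eq_bigr => g _ /=.
rewrite [RHS]exchange_big; apply: eq_bigr => h _ /=.
rewrite [RHS]exchange_big; apply: eq_bigr => g' _ /=.
by rewrite [RHS]exchange_big; apply: eq_bigr => h' _ /=.
Qed.

(** Here [eps] comes from the nontrivial commutators, [K ^+ 2 / N] from the trivial one, and
    [(1 - beta) ^+ 2] from the proportion of good pairs. *)
Definition energy_bound : R := 1 + eps + K ^+ 2 / N - (1 - beta) ^+ 2.

Lemma sum_good_energy :
  \sum_y \sum_y' (good y)%:R * (good y')%:R * pair_energy R y y' <=
  N ^+ 2 * energy_bound.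
Proof.
have -> : \sum_y \sum_y' (good y)%:R * (good y')%:R * pair_energy R y y' =
  N * (\sum_y \sum_y' (good y)%:R * (good y')%:R * \sum_w pair_law R y y' w ^+ 2)
  - (\sum_y (good y)%:R) ^+ 2.
  rewrite expr2 big_distrlr big_distrr -sumrB /=; apply: eq_bigr => y _.
  rewrite big_distrr -sumrB /=; apply: eq_bigr => y' _.
  by rewrite /pair_energy; ring.
rewrite sum_good_sqr_pair_law /energy_bound mulrBr; apply: lerB.
  have H : 0 <= N * N^-1 ^+ 4 by rewrite mulr_ge0 ?exprn_ge0 ?invr_ge0 ?(ltW N0).
  rewrite mulrA; apply: le_trans (ler_wpM2l H sum_quotients_le) _.
  by rewrite le_eqVlt; apply/orP; left; apply/eqP; field.
rewrite -exprMn mulrC; apply: lerXn2r; rewrite ?nnegrE //.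
  by rewrite mulr_ge0 ?subr_ge0 ?(ltW N0).
by apply: sumr_ge0 => y _; rewrite ler0n.
Qed.

Variable theta : R.
Hypothesis theta0 : 0 < theta.

(* By AM-GM, [(e / theta + theta) / 2] dominates the square root of [e]. *)
Definition energy_lam y y' : R :=
  if good y && good y'
  then Num.min 1 ((pair_energy R y y' / theta + theta) / 2) else 1.

Lemma energy_lam_ge0 y y' : 0 <= energy_lam y y'.
Proof.
rewrite /energy_lam; case: ifP => // _; rewrite le_min ler01 /=.
by rewrite divr_ge0 // addr_ge0 ?(ltW theta0) // divr_ge0 ?pair_energy_ge0 ?(ltW theta0).
Qed.

Lemma energy_lam_le1 y y' : energy_lam y y' <= 1.
Proof. by rewrite /energy_lam; case: ifP => // _; rewrite ge_min lexx. Qed.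

Lemma energy_lamP y y' (phi : gT -> R) : \sum_z phi z = 0 ->
  \sum_z conj_avg y (conj_avg y' phi) z ^+ 2 <=
  energy_lam y y' ^+ 2 * \sum_z phi z ^+ 2.
Proof.
move=> phi0.
have c1 : \sum_z conj_avg y (conj_avg y' phi) z ^+ 2 <= 1 ^+ 2 * \sum_z phi z ^+ 2.
  by rewrite expr1n mul1r; do 2!apply: le_trans (conj_avg_contract _ _) _.
rewrite /energy_lam; case: ifP => // _; rewrite /Num.min; case: ifP => // _.
apply: le_trans (conj_avg2_contract _ _ phi0) _; apply: ler_wpM2r.
  by apply: sumr_ge0 => z _; rewrite sqr_ge0.
set e := pair_energy R y y'.
have -> : e = (e / theta) * theta by rewrite divfK // gt_eqF.
by rewrite mulfK ?gt_eqF //; have := sqr_ge0 (e / theta - theta); lra.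
Qed.

(** Since [energy_lam] is bounded linearly in the energy, the mean energy suffices. The pairs that
    are not good count with factor 1 and have proportion at most [1 - (1 - beta) ^+ 2]. *)
Lemma mean_energy_lam :
  mean_lam energy_lam <= (energy_bound / theta + theta) / 2 + (1 - (1 - beta) ^+ 2).
Proof.
have t0 : theta != 0 by rewrite gt_eqF.
rewrite /mean_lam ler_pdivrMl // ler_pdivrMl //.
apply: (@le_trans _ _ (\sum_y \sum_y' ((2 * theta)^-1 *
   ((good y)%:R * (good y')%:R * pair_energy R y y') + (theta / 2 + 1) -
   (good y)%:R * (good y')%:R))).
  apply: ler_sum => y _; apply: ler_sum => y' _; rewrite /energy_lam.
  have th0 : 0 <= theta / 2 by rewrite divr_ge0 ?(ltW theta0).
  case: (good y) => /=; last by rewrite !(mul0r, mulr0, subr0, add0r) lerDr.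
  case: (good y') => /=; last by rewrite !(mul0r, mulr0, subr0, add0r) lerDr.
  rewrite ge_min; apply/orP; right; rewrite le_eqVlt; apply/orP; left; apply/eqP.
  by field.
set S := leLHS; have -> : S = (2 * theta)^-1 * (\sum_y \sum_y'
   ((good y)%:R * (good y')%:R * pair_energy R y y')) + N * (N * (theta / 2 + 1)) -
   (\sum_y (good y)%:R) ^+ 2.
  rewrite /S -!(sum_constN gT) expr2 big_distrlr big_distrr -big_split -sumrB /=.
  apply: eq_bigr => y _; rewrite big_distrr -big_split -sumrB /=.
  by apply: eq_bigr => y' _.
have i0 : 0 <= (2 * theta)^-1 by rewrite invr_ge0 mulr_ge0 ?(ltW theta0).
have E := ler_wpM2l i0 sum_good_energy.
have G : ((1 - beta) * N) ^+ 2 <= (\sum_y (good y)%:R) ^+ 2.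
  apply: lerXn2r; rewrite ?nnegrE //; first by rewrite mulr_ge0 ?subr_ge0 ?(ltW N0).
  by apply: sumr_ge0 => y _; rewrite ler0n.
have -> : N * (N * ((energy_bound / theta + theta) / 2 + (1 - (1 - beta) ^+ 2))) =
   (2 * theta)^-1 * (N ^+ 2 * energy_bound) + N * (N * (theta / 2 + 1)) -
   ((1 - beta) * N) ^+ 2 by field.
by lra.
Qed.

End CommutatorEnergy.

(** * Counting in SL(2,q) *)

Section Counting.

Lemma card_split (T T1 T2 : finType) (S : {set T}) (P : pred T)
    (f : T -> T1) (g : T -> T2) :
  {in [set x in S | P x] &, injective f} ->
  {in [set x in S | ~~ P x] &, injective g} -> (#|S| <= #|T1| + #|T2|)%N.
Proof.
move=> injf injg; rewrite -(cardsID [set x | P x] S).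
have -> : S :&: [set x | P x] = [set x in S | P x].
  by apply/setP => x; rewrite !inE.
have -> : S :\: [set x | P x] = [set x in S | ~~ P x].
  by apply/setP => x; rewrite !inE andbC.
by apply: leq_add; [exact: leq_card_in injf | exact: leq_card_in injg].
Qed.

(** Used to derive an equation from hypotheses: [d] is a combination of them, the first premise is
    left to [ring], and the second follows by substitution. *)
Lemma eqf_sub (F : fieldType) (x y d : F) : x - y = d -> d = 0 -> x = y.
Proof. by move=> <- /eqP; rewrite subr_eq0 => /eqP. Qed.

(** A square has at most two roots, and the test against [r0] tells them apart. This is the source
    of the [bool] factor in the counts below. *)
Lemma eqf_sqr_pick (F : fieldType) (r s r0 : F) :
  r ^+ 2 = r0 ^+ 2 -> s ^+ 2 = r0 ^+ 2 -> (r == r0) = (s == r0) -> r = s.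
Proof.
move=> /eqP; rewrite eqf_sqr => rE /eqP; rewrite eqf_sqr => sE.
case/orP: rE => /eqP ->; first by rewrite eqxx => /esym /eqP.
case/orP: sE => /eqP -> //; by rewrite eqxx => /eqP.
Qed.

Variable F : finFieldType.
Local Notation q := #|F|.

(* [(p, r, s, u)] is the matrix with rows [(p, r)] and [(s, u)]; for a matrix
   [W], [tr (x *m W) = 0] is the linear equation with coefficients [A = W 0 0],
   [B = W 1 0], [C = W 0 1], [D = W 1 1]. *)
Definition quadric_section (A B C D : F) : {set F * F * F * F} :=
  [set x | let: (p, r, s, u) := x in
    (p * u - r * s == 1) && (p * A + r * B + s * C + u * D == 0)].

Lemma quadric_sectionP A B C D p r s u :
  ((p, r, s, u) \in quadric_section A B C D) ->
  p * u - r * s - 1 = 0 /\ p * A + r * B + s * C + u * D = 0.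
Proof. by rewrite inE => /andP[/eqP -> /eqP ->]; rewrite subrr. Qed.

Lemma card_pairs : #|{: F * F}| = (q * q)%N. Proof. exact: card_prod. Qed.

Lemma card_bool_pairs : #|{: bool * F}| = (2 * q)%N.
Proof. by rewrite card_prod card_bool. Qed.

(** The linear equation gives [s], and the quadric becomes [p (u C + r A) + r^2 B + r u D = C]. If
    [u C + r A != 0], then [(r, u)] determines [p]. Otherwise [u] is determined by [r],
    [r^2 (B C - A D) = C^2] leaves at most two values of [r], and [p] is free. *)
Lemma card_quadric_section_offdiag (A B C D : F) : C != 0 ->
  (#|quadric_section A B C D| <= q * q + 2 * q)%N.
Proof.
move=> C0; rewrite -card_pairs -card_bool_pairs.
have sE p r s u p' : p * A + r * B + s * C + u * D = 0 -> forall s',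
    p' * A + r * B + s' * C + u * D = 0 -> p = p' -> s = s'.
  move=> h s' h' ep; subst p'; apply: (mulIf C0).
  apply: (@eqf_sub _ _ _ ((p * A + r * B + s * C + u * D) -
    (p * A + r * B + s' * C + u * D))); first ring.
  by rewrite h h' subrr.
pose S := quadric_section A B C D.
pose P (x : F * F * F * F) := x.2 * C + x.1.1.2 * A != 0.
have injf : {in [set x in S | P x] &, injective (fun x => (x.1.1.2, x.2))}.
  move=> [[[p r] s] u] [[[p' r'] s'] u'].
  rewrite [in X in X -> _]inE [in X in _ -> X -> _]inE /P /=.
  move=> /andP[/quadric_sectionP[h1 h2] k0] /andP[/quadric_sectionP[h1' h2'] _].
  move=> [er eu]; subst r' u'.
  have ep : p = p'.
    apply: (mulIf k0); apply: (@eqf_sub _ _ _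
      (C * (p * u - r * s - 1) + r * (p * A + r * B + s * C + u * D)
      - (C * (p' * u - r * s' - 1) + r * (p' * A + r * B + s' * C + u * D)))).
      by ring.
    by rewrite h1 h2 h1' h2' !mulr0 addr0 subrr.
  by rewrite (sE _ _ _ _ _ h2 _ h2' ep) ep.
case: (pickP (fun x => (x \in S) && ~~ P x)) => [[[[p0 r0] s0] u0] /andP[x0S x0P]|noP].
  apply: (card_split injf (g := fun x => (x.1.1.2 == r0, x.1.1.1))).
  pose X := B * C - A * D.
  have rX p r s u : (p, r, s, u) \in S -> ~~ P (p, r, s, u) ->
     r ^+ 2 * X = C ^+ 2 /\ u = - (r * A) / C.
    rewrite /P negbK => /quadric_sectionP[h1 h2] /eqP /= k0; split.
      apply: (@eqf_sub _ _ _ (C * (C * (p * u - r * s - 1) +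
         r * (p * A + r * B + s * C + u * D)) - (C * p + r * D) * (u * C + r * A))).
        by rewrite /X; ring.
      by rewrite h1 h2 k0; ring.
    apply: (mulIf C0); rewrite divfK //.
    by apply: (@eqf_sub _ _ _ (u * C + r * A)); [ring | rewrite k0].
  have [r0X _] := rX _ _ _ _ x0S x0P.
  have X0 : X != 0.
    apply/eqP => X0; move: r0X; rewrite X0 mulr0 => /esym/eqP.
    by rewrite sqrf_eq0 (negbTE C0).
  move=> [[[p r] s] u] [[[p' r'] s'] u'].
  rewrite [in X in X -> _]inE [in X in _ -> X -> _]inE.
  move=> /andP[xS xP] /andP[xS' xP'] /= [er ep].
  have [rE uE] := rX _ _ _ _ xS xP; have [rE' uE'] := rX _ _ _ _ xS' xP'.
  have err : r = r'.
    by apply: eqf_sqr_pick er; apply: (mulIf X0); rewrite r0X.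
  subst r' p'; have eu : u = u' by rewrite uE uE'.
  have [_ h2] := quadric_sectionP xS; have [_ h2'] := quadric_sectionP xS'.
  by rewrite -eu in h2' *; rewrite (sE _ _ _ _ _ h2 _ h2' erefl).
apply: (card_split injf (g := fun=> (true, 0))).
by move=> x y; rewrite [in X in X -> _]inE noP.
Qed.

(** The linear equation gives [u] from [p]. If [r != 0], then [(p, r)] determines [s]; if [r = 0],
    then [p^2 = - D / A] and [s] is free. *)
Lemma card_quadric_section_diag (A D : F) : A != 0 -> D != 0 ->
  (#|quadric_section A 0%R 0%R D| <= q * q + 2 * q)%N.
Proof.
move=> A0 D0; rewrite -card_pairs -card_bool_pairs.
pose S := quadric_section A 0 0 D.
have uE p r s u : (p, r, s, u) \in S -> u = - (p * A) / D.
  move=> /quadric_sectionP[_ h]; apply: (mulIf D0); rewrite divfK //.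
  by apply: (@eqf_sub _ _ _ (p * A + r * 0 + s * 0 + u * D)); [ring | rewrite h].
pose P (x : F * F * F * F) := x.1.1.2 != 0.
pose f (x : F * F * F * F) := (x.1.1.1, x.1.1.2).
have injf : {in [set x in S | P x] &, injective f}.
  move=> [[[p r] s] u] [[[p' r'] s'] u'].
  rewrite [in X in X -> _]inE [in X in _ -> X -> _]inE /P /f /=.
  move=> /andP[xS r0] /andP[xS' _] [ep er]; subst p' r'.
  have eu : u = u' by rewrite (uE _ _ _ _ xS) (uE _ _ _ _ xS').
  subst u'; have [h _] := quadric_sectionP xS; have [h' _] := quadric_sectionP xS'.
  have -> // : s = s'.
  apply: (mulfI r0); apply: (@eqf_sub _ _ _
    ((p * u - r * s' - 1) - (p * u - r * s - 1))); first ring.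
  by rewrite h h' subrr.
case: (pickP (fun x => (x \in S) && ~~ P x)) => [[[[p0 r0] s0] u0] /andP[x0S x0P]|noP].
  apply: (card_split injf (g := fun x => (x.1.1.1 == p0, x.1.2))).
  have pE p r s u : (p, r, s, u) \in S -> ~~ P (p, r, s, u) -> p ^+ 2 = - D / A.
    rewrite /P negbK => xS /eqP /= r_0; subst r; have [h _] := quadric_sectionP xS.
    have eu := uE _ _ _ _ xS; apply: (mulIf A0); rewrite divfK //.
    apply: (@eqf_sub _ _ _ (- D * (p * u - 0 * s - 1))); last by rewrite h mulr0.
    by rewrite eu; field.
  move=> [[[p r] s] u] [[[p' r'] s'] u'].
  rewrite [in X in X -> _]inE [in X in _ -> X -> _]inE.
  move=> /andP[xS xP] /andP[xS' xP'] /= [ep es]; subst s'.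
  have e : p = p'.
    have E0 := pE _ _ _ _ x0S x0P.
    have E1 := pE _ _ _ _ xS xP; have E2 := pE _ _ _ _ xS' xP'.
    by apply: eqf_sqr_pick ep; rewrite ?E1 ?E2 E0.
  subst p'; rewrite (uE _ _ _ _ xS) (uE _ _ _ _ xS').
  by move: xP xP'; rewrite /P !negbK /= => /eqP -> /eqP ->.
apply: (card_split injf (g := fun=> (true, 0))).
by move=> x y; rewrite [in X in X -> _]inE noP.
Qed.

Lemma card_quadric_section (A B C D : F) :
  (C != 0) || (B != 0) || (A != 0) && (D != 0) ->
  (#|quadric_section A B C D| <= q * q + 2 * q)%N.
Proof.
have [C0|C0] := eqVneq C 0; last by move=> _; exact: card_quadric_section_offdiag.
have [B0|B0] := eqVneq B 0 => /=; last first.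
  (* Transposing the matrices exchanges [r] with [s] and [B] with [C]. *)
  move=> _; apply: leq_trans (card_quadric_section_offdiag A C D B0).
  pose f (x : F * F * F * F) := (x.1.1.1, x.1.2, x.1.1.2, x.2).
  have f_inj : injective f by move=> [[[p r] s] u] [[[p' r'] s'] u'] [-> -> -> ->].
  rewrite -(card_imset _ f_inj); apply: subset_leq_card.
  apply/subsetP => _ /imsetP[[[[p r] s] u] xS ->].
  have [h1 h2] := quadric_sectionP xS; rewrite inE /=.
  rewrite -[_ == 1]subr_eq0 [s * r]mulrC h1 eqxx /=.
  by rewrite -h2; apply/eqP; ring.
by rewrite B0 C0 => /andP[A0 D0]; exact: card_quadric_section_diag.
Qed.

End Counting.

(** * The group SL(2,q): order, centralizers, traces *)

Section SpecialLinear2.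
Variable F : finFieldType.

Definition SLg : Type := SL2 F.
HB.instance Definition _ := Finite.on SLg.

Implicit Types a b z : SLg.

Definition SL_mul a b : SLg :=
  exist _ (val a *m val b) (introT eqP (etrans (det_mulmx _ _)
    (etrans (congr2 *%R (eqP (valP a)) (eqP (valP b))) (mulr1 1)))).

Definition SL_one : SLg := exist _ 1%:M (introT eqP (det1 F 2)).

Definition SL_inv a : SLg :=
  exist _ (invmx (val a)) (introT eqP (etrans (det_inv (val a))
    (etrans (congr1 (fun x => x^-1) (eqP (valP a))) (invr1 F)))).

Lemma SL_mulA : associative SL_mul.
Proof. by move=> a b c; apply: val_inj; exact: mulmxA. Qed.

Lemma SL_mul1 : left_id SL_one SL_mul.
Proof. by move=> a; apply: val_inj; exact: mul1mx. Qed.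

Lemma SL_mulV : left_inverse SL_one SL_inv SL_mul.
Proof.
move=> a; apply: val_inj; apply: mulVmx.
by rewrite unitmxE (eqP (valP a)) unitr1.
Qed.

HB.instance Definition _ := Finite_isGroup.Build SLg SL_mulA SL_mul1 SL_mulV.

Lemma det_2x2 (M : 'M[F]_2) : \det M = M 0 0 * M 1 1 - M 0 1 * M 1 0.
Proof.
rewrite (expand_det_row _ 0) !big_ord_recl big_ord0 addr0 /cofactor /=.
rewrite !det_mx11 !mxE /= expr0 expr1 mul1r mulN1r mulrN.
by congr (M _ _ * M _ _ - M _ _ * M _ _); apply: val_inj.
Qed.

Lemma matrix2P (M M' : 'M[F]_2) : M 0 0 = M' 0 0 -> M 0 1 = M' 0 1 ->
  M 1 0 = M' 1 0 -> M 1 1 = M' 1 1 -> M = M'.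
Proof.
move=> e00 e01 e10 e11; apply/matrixP => i j.
have two (k : 'I_2) : (k == 0) || (k == 1) by case: k => [[|[|k]]].
by case/orP: (two i) => /eqP ->; case/orP: (two j) => /eqP ->.
Qed.

Lemma mulmx2E (M M' : 'M[F]_2) i j : (M *m M') i j = M i 0 * M' 0 j + M i 1 * M' 1 j.
Proof.
rewrite mxE !big_ord_recl big_ord0 addr0.
by congr (_ + M _ _ * M' _ _); apply: val_inj.
Qed.

Definition entries a : F * F * F * F :=
  (val a 0 0, val a 0 1, val a 1 0, val a 1 1).

Lemma entries_inj : injective entries.
Proof. by move=> a b [*]; apply: val_inj; apply: matrix2P. Qed.

Lemma SL_det a : val a 0 0 * val a 1 1 - val a 0 1 * val a 1 0 = 1.
Proof. by rewrite -det_2x2; exact/eqP/(valP a). Qed.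

Lemma val_mulSL a b : val (a * b)%g = val a *m val b. Proof. by []. Qed.
Lemma val_oneSL : val (1%g : SLg) = 1%:M. Proof. by []. Qed.

Lemma card_SL_le : (#|{: SLg}| <= #|F| ^ 4)%N.
Proof.
apply: leq_trans (leq_card _ entries_inj) _.
by rewrite !card_prod !expnS expn0 !muln1 !mulnA.
Qed.

Lemma card_SL_ge : (#|F| ^ 2 * #|F|.-1 <= #|{: SLg}|)%N.
Proof.
pose M (x : F * F * {a : F | a != 0}) : 'M[F]_2 := \matrix_(i, j)
  (if i == 0 then (if j == 0 then val x.2 else x.1.1)
   else (if j == 0 then x.1.2 else (1 + x.1.1 * x.1.2) / val x.2)).
have detM x : \det (M x) == 1.
  rewrite det_2x2 !mxE /= mulrC divfK ?(valP x.2) //.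
  by rewrite addrK.
pose f x : SLg := exist _ (M x) (detM x).
have f_inj : injective f.
  move=> [[b c] [a a0]] [[b' c'] [a' a0']] /(congr1 val) /matrixP e.
  have := e 0 0; have := e 0 1; have := e 1 0; rewrite !mxE /= => -> -> ea.
  by congr (_, _); apply: val_inj.
apply: leq_trans (leq_card f f_inj).
rewrite !card_prod card_sig -mulnn leq_mul //.
by rewrite -(cardC1 (0 : F)) ; apply: eq_leq; apply: eq_card => x; rewrite !inE.
Qed.

Definition SL_tr a : F := val a 0 0 + val a 1 1.

(** The entry condition makes [a] non-scalar and gives coordinates on its centralizer; the trace
    condition keeps the conic of [card_SL_cent] nondegenerate. *)
Definition SL_good a : bool :=
  [&& val a 0 1 != 0, SL_tr a != 2 & SL_tr a != - 2].

Lemma card_SL_bad : (#|[set a : SLg | ~~ SL_good a]| <= 3 * #|F| ^ 2)%N.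
Proof.
pose T (t : F) := [set a : SLg | (val a 0 1 != 0) && (SL_tr a == t)].
have cT t : (#|T t| <= #|F| ^ 2)%N.
  rewrite -mulnn -card_prod.
  apply: (@leq_card_in _ _ (fun a : SLg => (val a 0 0, val a 0 1))) => a b.
  rewrite !inE => /andP[b0 /eqP ta] /andP[_ /eqP tb] [e00 e01].
  have e11 : val a 1 1 = val b 1 1.
    by apply: (addrI (val a 0 0)); rewrite [LHS]ta e00 -tb.
  apply: entries_inj; congr (_, _, _, _) => //.
  apply: (mulfI b0); apply: (@eqf_sub _ _ _
    ((val b 0 0 * val b 1 1 - val b 0 1 * val b 1 0) -
     (val a 0 0 * val a 1 1 - val a 0 1 * val a 1 0))).
    by rewrite e00 e01 e11; ring.
  by rewrite !SL_det subrr.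
pose B := [set a : SLg | val a 0 1 == 0].
have cB : (#|B| <= #|F| ^ 2)%N.
  rewrite -mulnn -card_prod.
  apply: (@leq_card_in _ _ (fun a : SLg => (val a 0 0, val a 1 0))) => a b.
  rewrite !inE => /eqP a01 /eqP b01 [e00 e10].
  have := SL_det a; have := SL_det b; rewrite a01 b01 !mul0r !subr0 -e00 => hb ha.
  have a0 : val a 0 0 != 0.
    by apply/eqP => a0; move: ha; rewrite a0 mul0r => /esym/eqP; rewrite oner_eq0.
  apply: entries_inj; congr (_, _, _, _) => //; first by rewrite a01 b01.
  by apply: (mulfI a0); rewrite ha hb.
have sub : [set a : SLg | ~~ SL_good a] \subset B :|: (T 2 :|: T (- 2)).
  apply/subsetP => a; rewrite !inE /SL_good; case: eqP => //= _.
  by rewrite negb_and !negbK.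
apply: leq_trans (subset_leq_card sub) _.
apply: leq_trans (leq_card_setU _ _) _.
have -> : (3 * #|F| ^ 2 = #|F| ^ 2 + (#|F| ^ 2 + #|F| ^ 2))%N by rewrite mulSn mulSn mul1n.
by apply: leq_add => //; apply: leq_trans (leq_card_setU _ _) _; apply: leq_add.
Qed.

(** An element commuting with [a] has the form [u + v a], with [u^2 + tr(a) u v + v^2 = 1]. The
    points of this conic with [v != 0] are parametrized by the slope [s = (u - 1) / v] of a line
    through [(1, 0)]; those with [v = 0] have [u = 1] or [u = -1]. *)
Lemma card_SL_cent a : SL_good a ->
  (#|[set b : SLg | (a * b == b * a)%g]| <= #|F| + 2)%N.
Proof.
move=> /and3P[a01 t2 tN2]; rewrite -card_bool.
pose v b := val b 0 1 / val a 0 1.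
pose u b := val b 0 0 - v b * val a 0 0.
have bE b : (a * b == b * a)%g -> val b = (u b)%:M + v b *: val a.
  move=> /eqP /(congr1 val); rewrite !val_mulSL => /matrixP e.
  have e00 := e 0 0; have e01 := e 0 1; rewrite !mulmx2E in e00 e01.
  have b01 : v b * val a 0 1 = val b 0 1 by rewrite divfK.
  apply: matrix2P; rewrite !mxE /= ?mulr1n ?mulr0n ?add0r //.
  - by rewrite /u subrK.
  - apply: (mulfI a01); apply: (@eqf_sub _ _ _ ((val a 0 0 * val b 0 0 + val a 0 1 * val b 1 0) -
      (val b 0 0 * val a 0 0 + val b 0 1 * val a 1 0))); last by rewrite e00 subrr.
    by rewrite -b01; ring.
  - apply: (mulfI a01); apply: (@eqf_sub _ _ _ ((val a 0 0 * val b 0 1 + val a 0 1 * val b 1 1) -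
      (val b 0 0 * val a 0 1 + val b 0 1 * val a 1 1))); last by rewrite e01 subrr.
    by rewrite /u -b01; ring.
have uv b : (a * b == b * a)%g ->
    u b ^+ 2 + SL_tr a * u b * v b + v b ^+ 2 - 1 = 0.
  move=> /bE e; have := SL_det b; rewrite e !mxE /= ?mulr1n ?mulr0n ?add0r => <-.
  have := SL_det a; rewrite /SL_tr => da.
  apply: (@eqf_sub _ _ _ (- v b ^+ 2 * (val a 0 0 * val a 1 1 - val a 0 1 * val a 1 0 - 1))).
    by ring.
  by rewrite da subrr mulr0.
apply: (card_split (P := fun b => v b != 0) (f := fun b => (u b - 1) / v b)
   (g := fun b => u b == 1)).
  move=> b b'; rewrite !inE => /andP[cb vb] /andP[cb' vb'].
  set s := (u b - 1) / v b => es.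
  have ub : u b = 1 + s * v b by rewrite /s divfK // addrC subrK.
  have ub' : u b' = 1 + s * v b' by rewrite es divfK // addrC subrK.
  have red w x : w != 0 -> x = 1 + s * w -> x ^+ 2 + SL_tr a * x * w + w ^+ 2 - 1 = 0 ->
      w * (s ^+ 2 + SL_tr a * s + 1) = - (2 * s + SL_tr a).
    move=> w0 -> h; apply: (mulfI w0); apply: eqf_sub h; ring.
  have r1 := red _ _ vb ub (uv _ cb); have r2 := red _ _ vb' ub' (uv _ cb').
  (* If this coefficient vanished, then also [tr(a) = - 2 s], hence [s^2 = 1] and the trace would be
     2 or -2. *)
  have k0 : s ^+ 2 + SL_tr a * s + 1 != 0.
    apply/eqP => k; move: r1; rewrite k mulr0 => /esym/eqP; rewrite oppr_eq0 => /eqP ts.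
    have st : SL_tr a = - (2 * s).
      by apply: (@eqf_sub _ _ _ (2 * s + SL_tr a)); [ring | ].
    have : s ^+ 2 == 1 ^+ 2.
      rewrite -subr_eq0; apply/eqP; rewrite -[LHS]opprK -[RHS]oppr0; congr (- _).
      by rewrite -k st; ring.
    rewrite eqf_sqr => /orP[] /eqP s1.
      by move: tN2; rewrite st s1 mulr1 eqxx.
    by move: t2; rewrite st s1 mulrN1 opprK eqxx.
  have ev : v b = v b' by apply: (mulIf k0); rewrite r1 r2.
  by apply: val_inj; rewrite (bE _ cb) (bE _ cb') ub ub' ev.
move=> b b'; rewrite !inE !negbK => /andP[cb /eqP vb] /andP[cb' /eqP vb'] eu.
have u1 x : (a * x == x * a)%g -> v x = 0 -> u x ^+ 2 = 1 ^+ 2.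
  move=> cx vx; have := uv _ cx; rewrite vx => h.
  by apply: eqf_sub h; ring.
have e : u b = u b' by apply: eqf_sqr_pick eu; apply: u1.
by apply: val_inj; rewrite (bE _ cb) (bE _ cb') e vb vb'.
Qed.

Lemma card_SL_eq_trace z : z != 1%g ->
  (#|[set a : SLg | SL_tr (a * z)%g == SL_tr a]| <= #|F| * #|F| + 2 * #|F|)%N.
Proof.
move=> z1; rewrite -(card_imset _ entries_inj).
apply: leq_trans (@card_quadric_section F (val z 0 0 - 1) (val z 1 0)
  (val z 0 1) (val z 1 1 - 1) _).
  apply: subset_leq_card; apply/subsetP => _ /imsetP[a aS ->].
  move: aS; rewrite !inE /entries /= => /eqP; rewrite /SL_tr !mulmx2E => h.
  rewrite SL_det eqxx /=; apply/eqP.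
  apply/eqP; move/eqP: h; rewrite -subr_eq0 => /eqP h; rewrite -h; apply/eqP; ring.
(* If the trace equation is too degenerate for the quadric count, [z] is diagonal with an entry
   equal to 1; determinant one forces the other to be 1. *)
apply: contraR z1; rewrite !negb_or !negbK => /andP[/andP[/eqP z01 /eqP z10] zd].
have dz := SL_det z; rewrite z01 mul0r subr0 in dz.
have [z00 z11] : val z 0 0 = 1 /\ val z 1 1 = 1.
  move: zd; rewrite negb_and !negbK !subr_eq0 => /orP[] /eqP e; rewrite e in dz *.
    by rewrite mul1r in dz.
  by rewrite mulr1 in dz.
apply/eqP; apply: val_inj; apply: matrix2P;
  by rewrite val_oneSL !mxE /= ?z00 ?z01 ?z10 ?z11.
Qed.

Lemma SL_trJ a b : SL_tr (a ^ b)%g = SL_tr a.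
Proof.
have trE c : SL_tr c = \tr (val c).
  by rewrite /mxtrace !big_ord_recl big_ord0 addr0; congr (_ + val c _ _); apply: val_inj.
rewrite !trE conjgE !val_mulSL mulmxA mxtrace_mulC mulmxA -!val_mulSL.
by rewrite mulgV mul1g.
Qed.

End SpecialLinear2.

(** * The contraction rate for SL(2,q) *)

Section SL2Mixing.
Variables (R : rcfType) (F : finFieldType).
Hypothesis q_large : (625 <= #|F|)%N.

Local Notation G := (SLg F).
Local Notation N := (#|{: G}|%:R : R).
Local Notation q := (#|F|%:R : R).

Let q625 : 625 <= q. Proof. by rewrite (ler_nat R 625). Qed.
Let q0 : 0 < q. Proof. by apply: lt_le_trans q625; rewrite ltr0n. Qed.

Lemma card_conj_fiber (gT : finGroupType) (a c : gT) :
  (#|[set b | (a ^ b == c)%g]| <= #|[set b | (a * b == b * a)%g]|)%N.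
Proof.
have [->|[b0]] := set_0Vmem [set b | (a ^ b == c)%g]; first by rewrite cards0.
rewrite inE => /eqP b0P; rewrite -(card_imset _ (mulIg b0^-1%g)).
apply: subset_leq_card; apply/subsetP => _ /imsetP[b + ->].
rewrite !inE => /eqP bP; apply/eqP; apply/commgP/conjg_fixP.
by rewrite conjgM bP -b0P -conjgM mulgV conjg1.
Qed.

(** For given [a], the solutions [b] of [a^b = a z] lie in a coset of the centralizer of [a], and
    there are none unless [a z] and [a] have the same trace. *)
Lemma comm_count_SL (z : G) : comm_count R (@SL_good F) z <=
  (q + 2) * #|[set a : G | SL_tr (a * z)%g == SL_tr a]|%:R.
Proof.
have -> : (q + 2) * #|[set a : G | SL_tr (a * z)%g == SL_tr a]|%:R =
   \sum_(a : G) (q + 2) * (SL_tr (a * z)%g == SL_tr a)%:R.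
  rewrite -big_distrr /= -natr_sum; congr (_ * _%:R).
  by rewrite -sum1_card big_mkcond /=; apply: eq_bigr => a _; rewrite inE; case: eqP.
apply: ler_sum => a _; rewrite -big_distrr /=.
have [ga|_] := boolP (SL_good a); last by rewrite mul0r mulr_ge0 ?addr_ge0 ?(ltW q0).
rewrite mul1r -natr_sum.
have -> : (\sum_(b : G) ((a ^ b)%g == (a * z)%g))%N = #|[set b | (a ^ b == a * z)%g]|.
  by rewrite -sum1_card [RHS]big_mkcond /=; apply: eq_bigr => b _; rewrite inE; case: eqP.
case: eqP => [_|ntr] /=.
  rewrite mulr1 -natrD ler_nat; apply: leq_trans (card_conj_fiber _ _) _.
  exact: card_SL_cent.
rewrite mulr0 (_ : [set b | _] = set0) ?cards0 //; apply/setP => b; rewrite !inE.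
by apply/eqP => e; apply: ntr; rewrite -e SL_trJ.
Qed.

Lemma card_SL_lb : q ^+ 3 - q ^+ 2 <= N.
Proof.
have := card_SL_ge F; rewrite -(ler_nat R) natrM natrX.
rewrite -subn1 natrB; last exact: leq_trans q_large.
by apply: le_trans; rewrite mulrBr mulr1 -exprSr.
Qed.

Lemma card_SL_ub : N <= q ^+ 4.
Proof. by rewrite -natrX ler_nat card_SL_le. Qed.

Let N0 : 0 < N. Proof. exact: card_fin_gt0 (1%g : G). Qed.

Lemma comm_count_SL_le (z : G) : z != 1%g ->
  comm_count R (@SL_good F) z <= (1 + 6 / q) * N.
Proof.
move=> z1; apply: le_trans (comm_count_SL z) _.
have E : (#|[set a : G | SL_tr (a * z)%g == SL_tr a]|%:R : R) <= q * q + 2 * q.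
  by rewrite -!natrM -natrD ler_nat card_SL_eq_trace.
apply: le_trans (ler_wpM2l _ E) _; first by rewrite addr_ge0 ?(ltW q0).
apply: le_trans (ler_wpM2l _ card_SL_lb); last first.
  by rewrite addr_ge0 // divr_ge0 ?(ltW q0).
have -> : (1 + 6 / q) * (q ^+ 3 - q ^+ 2) = q ^+ 3 + 5 * q ^+ 2 - 6 * q.
  by field; rewrite gt_eqF.
by have := q625; nra.
Qed.

Lemma comm_count1_SL_le : comm_count R (@SL_good F) 1%g <= (q + 2) * N.
Proof.
apply: le_trans (comm_count_SL _) _; rewrite ler_wpM2l ?addr_ge0 ?(ltW q0) //.
by rewrite ler_nat max_card.
Qed.

Lemma SL_good_ge : (1 - 4 / q) * N <= \sum_(a : G) (SL_good a)%:R.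
Proof.
have E : \sum_(a : G) (SL_good a)%:R + \sum_(a : G) (~~ SL_good a)%:R = N.
  rewrite -big_split /= -[RHS]mulr1 -(sum_constN G).
  by apply: eq_bigr => a _; case: SL_good; rewrite ?addr0 ?add0r.
have B : \sum_(a : G) (~~ SL_good a)%:R <= 3 * q ^+ 2 :> R.
  rewrite -natr_sum -natrX -natrM ler_nat.
  apply: leq_trans (card_SL_bad F); apply: eq_leq.
  by rewrite -sum1_card [RHS]big_mkcond /=; apply: eq_bigr => a _; rewrite inE; case: SL_good.
have L : 4 / q * (q ^+ 3 - q ^+ 2) <= 4 / q * N.
  by rewrite ler_wpM2l ?card_SL_lb // divr_ge0 ?(ltW q0).
have M : 4 / q * (q ^+ 3 - q ^+ 2) = 4 * q ^+ 2 - 4 * q by field; rewrite gt_eqF.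
move: L; rewrite M => L.
have : 4 * q <= q ^+ 2 by have := q625; nra.
by move: E B L; lra.
Qed.

(** The budget: [6 / q] for nontrivial commutators, [2 / q] for the trivial one, [8 / q] for the
    elements that are not good. *)
Lemma energy_bound_SL : energy_bound G (6 / q) (q + 2) (4 / q) <= 16 / q.
Proof.
rewrite /energy_bound.
have H : (q + 2) ^+ 2 / N <= 2 / q.
  rewrite ler_pdivrMr // mulrAC ler_pdivlMr //.
  apply: le_trans (ler_wpM2l _ card_SL_lb) => //.
  by have := q625; nra.
have : 0 <= 16 / q ^+ 2 by rewrite divr_ge0 ?exprn_ge0 ?(ltW q0).
have -> : (1 - 4 / q) ^+ 2 = 1 - 8 / q + 16 / q ^+ 2 by field; rewrite gt_eqF.
have -> : 6 / q = 6 * (1 / q) by field; rewrite gt_eqF.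
have E : 16 / q = 6 * (1 / q) + 8 / q + 2 / q by field; rewrite gt_eqF.
by move: H; rewrite E; lra.
Qed.

(** The square root of the bound [16 / q], which balances the two terms of the AM-GM bound. *)
Let theta : R := 4 * (Num.sqrt q)^-1.
Let lam : G -> G -> R := energy_lam (@SL_good F) theta.

Let sq0 : 0 < Num.sqrt q. Proof. by rewrite sqrtr_gt0. Qed.
Let theta0 : 0 < theta. Proof. by rewrite mulr_gt0 // invr_gt0. Qed.

Lemma mean_lam_SL_ge0 : 0 <= mean_lam lam.
Proof.
rewrite /mean_lam !mulr_ge0 ?invr_ge0 ?(ltW N0) //.
by do 2!apply: sumr_ge0 => ? _; apply: energy_lam_ge0.
Qed.

(** The mean factor is at most [5 / sqrt q]: [4 / sqrt q] from good pairs, and the rest is of order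
    [1 / q]. Its fourth power is at most [625 / q^2], which is where the threshold [625 <= q] comes
    from. *)
Lemma mean_lam_SL : mean_lam lam ^+ 4 <= q^-1.
Proof.
set s := (Num.sqrt q)^-1.
have s0 : 0 < s by rewrite invr_gt0.
have sqrtK : Num.sqrt q ^+ 2 = q by rewrite sqr_sqrtr ?(ltW q0).
have s2 : s ^+ 2 = q^-1 by rewrite exprVn sqrtK.
have s25 : s <= 25^-1.
  rewrite lef_pV2 ?posrE // -(ler_pXn2r (ltn0Sn 1)) ?nnegrE ?(ltW sq0) // sqrtK.
  by apply: le_trans q625; lra.
have E := @mean_energy_lam R G (@SL_good F) (6 / q) (q + 2) (4 / q).
have {E} E : mean_lam lam <= 5 * s.
  apply: le_trans (E _ _ _ comm_count_SL_le comm_count1_SL_le SL_good_ge theta theta0) _.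
  - by rewrite divr_ge0 ?(ltW q0).
  - by rewrite addr_ge0 ?(ltW q0).
  - by rewrite ler_pdivrMr // mul1r; apply: le_trans q625; lra.
  have H : energy_bound G (6 / q) (q + 2) (4 / q) / theta <= 4 * s.
    rewrite ler_pdivrMr //; apply: le_trans energy_bound_SL _.
    rewrite -s2 /theta -/s; lra.
  move: H; set e := _ / theta => H.
  have -> : 4 / q = 4 * s ^+ 2 by rewrite s2.
  rewrite /theta -/s.
  have : s ^+ 2 <= s * 25^-1 by rewrite expr2 ler_wpM2l ?(ltW s0).
  have : 0 <= s ^+ 2 * s ^+ 2 by rewrite mulr_ge0 ?sqr_ge0.
  by lra.
apply: (@le_trans _ _ ((5 * s) ^+ 4)).
  by apply: lerXn2r => //; rewrite nnegrE ?mean_lam_SL_ge0 // mulr_ge0 // ltW.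
have -> : (5 * s) ^+ 4 = 625 * s ^+ 2 * s ^+ 2 by ring.
rewrite s2 -[leRHS]mul1r ler_wpM2r ?invr_ge0 ?(ltW q0) //.
by rewrite ler_pdivrMr // mul1r.
Qed.

(** There are [52 * 2^k] pairs, and [52 = 4 * 13] gives [q^(-13)] per coordinate of the cube: [q^5]
    pays for the factor [1 + N], and [q^8] for the gain [N^2]. *)
Lemma tower_collision_SL k :
  #|tower G k|%:R * collision R (@diag G k) (104 * expn 2 k) <= 1 + N^-1 ^+ 2.
Proof.
set M := expn 2 k.
have M0 : (0 < M)%N by rewrite expn_gt0.
have -> : (104 * M)%N = (52 * M).*2 by rewrite -mul2n mulnA.
apply: le_trans (@tower_collision R G lam _ _ _ k (52 * M)) _.
- exact: energy_lam_ge0.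
- exact: energy_lam_le1.
- exact: energy_lamP.
rewrite lerD2l -/M.
have -> : mean_lam lam ^+ (52 * M) = (mean_lam lam ^+ 4) ^+ 13 ^+ M.
  by rewrite -!exprM; congr (_ ^+ _); rewrite !mulnA.
have L : ((mean_lam lam) ^+ 4) ^+ 13 <= q^-1 ^+ 13.
  by apply: lerXn2r mean_lam_SL; rewrite nnegrE ?exprn_ge0 ?mean_lam_SL_ge0 ?invr_ge0 ?(ltW q0).
have U : 1 + N <= q ^+ 5.
  have := card_SL_ub; have q4 : 1 <= q ^+ 4.
    by rewrite exprn_ege1 //; apply: le_trans q625; lra.
  rewrite exprS; have := q625; nra.
have V : N ^+ 2 <= q ^+ 8.
  by rewrite -[8%N]/(4 * 2)%N exprM; apply: lerXn2r card_SL_ub; rewrite nnegrE ?exprn_ge0 ?(ltW q0) ?(ltW N0).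
rewrite -exprMn.
have W : (1 + N) * ((mean_lam lam) ^+ 4) ^+ 13 <= N^-1 ^+ 2.
  apply: (@le_trans _ _ (q ^+ 5 * q^-1 ^+ 13)).
    by apply: ler_pM => //; rewrite ?addr_ge0 ?exprn_ge0 ?mean_lam_SL_ge0 ?(ltW N0).
  have -> : q ^+ 5 * q^-1 ^+ 13 = (q ^+ 8)^-1 by field; rewrite gt_eqF.
  by rewrite exprVn lef_pV2 ?posrE ?exprn_gt0.
apply: le_trans (W).
have W0 : 0 <= (1 + N) * ((mean_lam lam) ^+ 4) ^+ 13.
  by rewrite mulr_ge0 ?addr_ge0 ?exprn_ge0 ?mean_lam_SL_ge0 ?(ltW N0).
rewrite -(prednK M0) exprS ler_piMr // exprn_ile1 //.
have N1 : N^-1 <= 1 by rewrite invf_le1 // ler1n; apply/card_gt0P; exists 1%g.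
by apply: le_trans W _; rewrite exprn_ile1 ?invr_ge0 ?(ltW N0).
Qed.

End SL2Mixing.

(** * Mixing of the cube distribution *)

Section CubeDistribution.
Variables (R : realFieldType) (gT : finGroupType).

Lemma pushw_cpow (h1 h2 : finGroupType) (phi : h1 -> h2) (w : h1 -> R) n :
  phi 1%g = 1%g -> {morph phi : x y / (x * y)%g} ->
  pushw phi (cpow w n) =1 cpow (pushw phi w) n.
Proof.
move=> phi1 phiM z; rewrite cpowE -iterE_push.
transitivity (\sum_a (phi a == z)%:R * cpow w n a).
  by rewrite /pushw big_mkcond /=; apply: eq_bigr => a _; case: eqP => _;
    rewrite ?mul1r ?mul0r.
under eq_bigr do rewrite cpowE -iterEZ.
rewrite -iterE_sum; apply: eq_iterE => s _.
rewrite (eq_bigr (fun a => (a == (\prod_(b <- s) b)%g)%:R * (phi a == z)%:R)).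
  by rewrite sum_delta big_map (big_morph phi phiM phi1).
by move=> a _; rewrite mulrC eq_sym.
Qed.

Lemma conv_invariant (h : finGroupType) (f g : h -> R) c z :
  (forall a, f (c * a)%g = f a) -> conv f g (c * z)%g = conv f g z.
Proof.
move=> fc; rewrite /conv (reindex_inj (mulgI c)) /=; apply: eq_bigr => a _.
by rewrite fc invMg -mulgA mulKg.
Qed.

Lemma distr_pushw (T U : finType) (f : T -> U) (w : T -> R) :
  distr w -> distr (pushw f w).
Proof.
move=> [w0 w1]; split=> [u|]; first exact: sumr_ge0.
rewrite -[RHS]w1; under eq_bigr do rewrite -[pushw f w _]mulr1.
by rewrite sum_pushw; under eq_bigr do rewrite mulr1.
Qed.

Lemma diagM k : {morph @diag gT k : x y / (x * y)%g}.
Proof. by elim: k => [|k IH] x y //=; rewrite IH. Qed.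

Lemma diag1 k : @diag gT k 1%g = 1%g.
Proof. by elim: k => [|k IH] //=; rewrite IH. Qed.

Local Notation tw := (tower gT).

Definition add_direction k (t : (gT * gT) * tw k) : tw k.+1 :=
  (diag k t.1.1 * t.2, diag k t.1.2 * t.2)%g.

(** The law of one column. The new direction supplies the leftmost factor, [t.1.1] on one face and
    [t.1.2] on the opposite one. *)
Fixpoint cube_distr k : tw k -> R :=
  if k is k'.+1 return tw k -> R
  then pushw (@add_direction k') (fun t => unif R t.1 * cube_distr t.2)
  else fun z => (z == 1%g)%:R.

Lemma distr_cube k : distr (@cube_distr k).
Proof.
elim: k => [|k [d0 d1]]; first exact: distr_delta.
apply: distr_pushw; split=> [t|]; first by rewrite mulr_ge0 ?unif_ge0.
rewrite -(pair_big predT predT (fun x h => unif R x * cube_distr h)) /=.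
under eq_bigr do rewrite -big_distrr /= d1 mulr1.
exact: sum_unif _ (1%g, 1%g).
Qed.

Lemma cube_distrS_invariant k u v (a b : tw k) :
  @cube_distr k.+1 (diag k u * a, diag k v * b)%g = @cube_distr k.+1 (a, b).
Proof.
rewrite /= /pushw.
pose f (t : (gT * gT) * tw k) := ((u * t.1.1, v * t.1.2)%g, t.2).
have f_inj : injective f by move=> [[x y] h] [[x' y'] h'] [/mulgI -> /mulgI -> ->].
rewrite (reindex_inj f_inj) /=; apply: eq_big => [[[x y] h]|//].
rewrite /add_direction /= !diagM -!mulgA !xpair_eqE.
by rewrite !(inj_eq (mulgI _)).
Qed.

Lemma cube_distr_diag k x (z : tw k) : (0 < k)%N ->
  cube_distr (diag k x * z)%g = cube_distr z.
Proof. by case: k z => // k [a b] _; apply: cube_distrS_invariant. Qed.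

(** A face carries [diag(x) * h] with [h] of law [cube_distr k], and the invariance of that law
    absorbs [diag(x)]. In dimension 0 the law is a point mass and is not invariant. *)
Lemma cube_marginal k (p : (gT * gT) -> gT) (phi : tw k.+1 -> tw k) :
  (0 < k)%N -> (forall t, phi (add_direction t) = (diag k (p t.1) * t.2)%g) ->
  pushw phi (@cube_distr k.+1) =1 @cube_distr k.
Proof.
move=> k0 phiE z.
transitivity (\sum_a @cube_distr k.+1 a * (phi a == z)%:R).
  by rewrite /pushw big_mkcond /=; apply: eq_bigr => a _; case: eqP => _;
    rewrite ?mulr1 ?mulr0.
rewrite sum_pushw -(pair_big predT predT (fun x h => unif R x * cube_distr h *
  (phi (add_direction (x, h)) == z)%:R)) /=.
transitivity (\sum_(x : gT * gT) unif R x * cube_distr z); last first.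
  by rewrite -big_distrl /= (sum_unif _ (1%g, 1%g)) mul1r.
apply: eq_bigr => x _; under eq_bigr do rewrite -mulrA.
rewrite -big_distrr /=; congr (_ * _).
rewrite -[RHS](@cube_distr_diag k (p x)^-1 _ k0).
rewrite -[RHS](sum_delta (fun h => cube_distr h)); apply: eq_bigr => h _.
rewrite phiE mulrC eq_mulg_move; congr ((_ == _ * _)%g%:R * _).
by apply/esym/eqP; rewrite eq_sym -(inj_eq (mulgI (diag k (p x)))) mulgV -diagM mulgV diag1.
Qed.

Lemma near_unif_cube1 : near_unif 0 (@cube_distr 1).
Proof.
move=> [a b]; rewrite /= /pushw.
rewrite (eq_bigl (fun t : gT * gT * gT => (t.1 == (a * t.2^-1, b * t.2^-1)%g))); last first.
  move=> [[x y] h]; rewrite /add_direction /= !xpair_eqE.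
  by congr (_ && _); rewrite -[RHS](inj_eq (mulIg h)) mulgKV.
have -> : \sum_(t : gT * gT * gT | t.1 == (a * t.2^-1, b * t.2^-1)%g)
   unif R t.1 * (t.2 == 1%g)%:R = unif R (a, b).
  rewrite (bigD1 ((a, b), 1%g)) /= ?invg1 ?mulg1 ?eqxx //= mulr1 big1 ?addr0 //.
  move=> [x h] /andP[/eqP /= ->] ne; have [h1|] := eqVneq h 1%g; last by rewrite mulr0.
  by case/eqP: ne; rewrite h1 invg1 !mulg1.
by rewrite /unif divff ?subrr ?normr0 // (card_neq0 _ (a, b)).
Qed.

(** A letter is a block of [r] columns: its first column provides the diagonal invariance, and its
    two faces are blocks of the lower dimension. *)
Lemma near_unif_cube_step k n r d : (0 < k)%N -> (0 < n)%N -> (0 < r)%N ->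
  near_unif d (cpow (@cube_distr k) r) ->
  near_unif ((1 + d) ^+ n * (#|tw k|%:R * collision R (@diag gT k) n) - 1 + 4 * d)
    (cpow (@cube_distr k.+1) (n * r)).
Proof.
move=> k0 n0 r0 nu.
apply: eq_near_unif (fun z => esym (cpowM _ _ _ z)) _.
have dS := distr_cpow r (@distr_cube k.+1).
apply: (@near_unif_step R gT 1%g (tw k) (@diag gT k) d _ n dS) => //.
- case: r r0 {nu dS} => // r _ u v a b /=.
  by apply: (@conv_invariant _ _ _ (diag k u, diag k v)) => -[a' b'];
    apply: cube_distrS_invariant.
- apply: eq_near_unif nu => z; rewrite pushw_cpow //.
  by apply: eq_cpow => {}z; rewrite (@cube_marginal k fst).
- apply: eq_near_unif nu => z; rewrite pushw_cpow //.
  by apply: eq_cpow => {}z; rewrite (@cube_marginal k snd).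
Qed.

End CubeDistribution.

(** * Choice of block lengths *)

Section SL2Cube.
Variables (R : rcfType) (F : finFieldType).
Hypothesis q_large : (625 <= #|F|)%N.

Local Notation N := (#|{: SLg F}|%:R : R).

Lemma card_SL_large : 1000 <= N.
Proof.
have := card_SL_lb R q_large; apply: le_trans.
have : 625 <= #|F|%:R :> R by rewrite (ler_nat R 625).
nra.
Qed.

(** With [104 <= 2^7] and [M <= 2^M], the growth factor [2 n^2] is at most [2^(15 + 2M)], hence at
    most [2^(18 M)], the room gained by doubling [M]. *)
Lemma step_length_le (s M : nat) : (0 < M)%N -> (2 * s <= 2 ^ (18 * M))%N ->
  (2 * (104 * M * (2 * (104 * M) * s)) <= 2 ^ (18 * (2 * M)))%N.
Proof.
move=> M0 sM; set n := (104 * M)%N.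
have nM : (n <= 2 ^ (7 + M))%N.
  by rewrite expnD; apply: leq_mul => //; apply: ltnW; apply: ltn_expl.
have -> : (2 * (n * (2 * n * s)) = 2 * n ^ 2 * (2 * s))%N.
  by rewrite expnS expn1; ring.
apply: leq_trans (leq_mul (leqnn _) sM) _.
have -> : (18 * (2 * M) = 18 * M + 18 * M)%N by ring.
rewrite expnD leq_mul //; apply: (@leq_trans (2 ^ (1 + 2 * (7 + M)))).
  by rewrite (expnD 2 1) expn1; apply: leq_mul => //; rewrite mulnC expnM leq_exp2r.
by rewrite leq_exp2l //; lia.
Qed.

(** The bound is on [2 * s] rather than [s] to absorb the rounding of [t / s] in [Rpower_neg_le]. *)
Lemma cube_mixing k : (0 < k)%N -> exists s : nat,
  [/\ (0 < s)%N, (2 * s <= 2 ^ (18 * expn 2 k))%N &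
      near_unif N^-1 (cpow (@cube_distr R (SLg F) k) s)].
Proof.
case: k => // k _; elim: k => [|k [s [s0 sM nu]]].
  exists 1%N; split=> //; apply: eq_near_unif (fun z => esym (cpow1 _ z)) _.
  by apply: near_unif_le (@near_unif_cube1 _ _); rewrite invr_ge0 ler0n.
set M := expn 2 k.+1 in sM *.
have M0 : (0 < M)%N by rewrite expn_gt0.
(* [n] letters, as [tower_collision_SL] requires, each a block of [l * s] columns; [l = 2 n] makes
   the error of a letter [x^(2n)]. *)
set n := (104 * M)%N; set l := (2 * n)%N.
have n0 : (0 < n)%N by rewrite muln_gt0.
have n3 : (3 <= n)%N by apply: (@leq_trans (104 * 1)) => //; rewrite leq_pmul2l.
set x : R := N^-1.
have N1000 := card_SL_large.
have Np : 0 < N by apply: lt_le_trans N1000.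
have x0 : 0 < x by rewrite invr_gt0.
have x1 : x <= 1000^-1 by rewrite lef_pV2 ?posrE.
have nul : near_unif (x ^+ l) (cpow (@cube_distr R (SLg F) k.+1) (l * s)).
  apply: eq_near_unif (fun z => esym (cpowM _ _ _ z)) _.
  apply: near_unif_cpow => //; first by rewrite muln_gt0.
  by apply: distr_cpow; apply: distr_cube.
exists (n * (l * s))%N; split.
- by rewrite !muln_gt0 M0 s0.
- by rewrite expnS -/M; apply: step_length_le.
apply: near_unif_le (near_unif_cube_step _ n0 _ nul) => //; last first.
  by rewrite !muln_gt0 M0 s0.
set d := x ^+ l.
have xle1 : x <= 1 by lra.
have x3 : x ^+ n <= x ^+ 3 by rewrite ler_wiXn2l ?(ltW x0).
have l3 : (3 <= l)%N by rewrite /l mul2n -addnn (leq_trans n3) ?leq_addr.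
have d0 : 0 <= d by rewrite exprn_ge0 ?ltW.
have d3 : d <= x ^+ 3 by rewrite ler_wiXn2l ?(ltW x0).
have dn : (1 + d) ^+ n <= 1 + x ^+ 3.
  (* The chord bound with [c = 1] gives [1 + 2^n d], and [2^n x^(2n) = (2 x^2)^n <= x^n]. *)
  rewrite -{1}[d]mul1r; apply: le_trans (expr1D_convex n ler01 _) _.
    by rewrite d0 (le_trans d3) // exprn_ile1 ?(ltW x0).
  rewrite lerD2l; apply: le_trans x3.
  rewrite /d /l exprM -exprMn; apply: lerXn2r; rewrite ?nnegrE ?(ltW x0) //.
    by rewrite mulr_ge0 ?addr_ge0 ?sqr_ge0.
  nra.
have C := tower_collision_SL R q_large k.+1.
have C0 : 0 <= #|tower (SLg F) k.+1|%:R * collision R (@diag (SLg F) k.+1) n.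
  rewrite mulr_ge0 // /collision; do 3!(apply: iterE_ge0 => [?|?]; first exact: unif_ge0).
  exact: ler0n.
have := ler_pM _ C0 dn C; rewrite exprn_ge0 ?addr_ge0 // => /(_ isT) H.
(* The total is [x^2 + 5 x^3 + x^5], at most [7 x^2], and [x <= 1/1000] brings this below [x]. *)
apply: (@le_trans _ _ ((1 + x ^+ 3) * (1 + x ^+ 2) - 1 + 4 * x ^+ 3)).
  by rewrite lerD ?ler_wpM2l // lerD2r; exact: H.
have x2 : x ^+ 2 <= x * 1000^-1 by rewrite expr2 ler_wpM2l ?(ltW x0).
have : 0 <= x ^+ 2 by rewrite sqr_ge0.
have : x ^+ 3 <= x ^+ 2 by rewrite ler_wiXn2l ?(ltW x0).
have : x ^+ 5 <= x ^+ 2 by rewrite ler_wiXn2l ?(ltW x0).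
lra.
Qed.

Lemma cube_mixing_rate k t (s : nat) : (0 < s)%N -> (s <= t)%N ->
  near_unif N^-1 (cpow (@cube_distr R (SLg F) k) s) ->
  near_unif (N^-1 ^+ (t %/ s)) (cpow (@cube_distr R (SLg F) k) t).
Proof.
move=> s0 st nu; rewrite [X in cpow _ X](divn_eq t s) addnC.
apply: near_unif_cpow_add; first exact: distr_cube.
apply: eq_near_unif (fun z => esym (cpowM _ _ _ z)) _.
by apply: near_unif_cpow => //; rewrite ?divn_gt0 //; apply: distr_cpow; apply: distr_cube.
Qed.

End SL2Cube.

(** * Identification of the sample space with sequences of columns *)

Section SampleSpace.
Variables (R : realFieldType) (gT : finGroupType).

Definition vertex_prod (xs : seq (gT * gT)) (bs : seq bool) : gT :=
  (\prod_(p <- zip xs bs) (if p.2 then p.1.2 else p.1.1))%g.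

(** Vertices are bit lists, so that peeling off a bit matches the nesting of pairs in [tower]. *)
Fixpoint cube_of k (f : seq bool -> gT) : tower gT k :=
  if k is k'.+1 return tower gT k
  then (cube_of k' (fun bs => f (false :: bs)), cube_of k' (fun bs => f (true :: bs)))
  else f [::].

Lemma cube_ofP k f f' :
  cube_of k f = cube_of k f' <-> (forall bs, size bs = k -> f bs = f' bs).
Proof.
elim: k f f' => [|k IH] f f' /=.
  by split=> [e [|//] _ //|e]; apply: e.
split=> [[/IH e0 /IH e1] [|[] bs] // [sz]|e]; [exact: e1 | exact: e0 |].
by congr (_, _); apply/IH => bs sz; apply: e; rewrite /= sz.
Qed.

Lemma cube_of1 k : cube_of k (fun=> 1%g) = 1%g.
Proof. by elim: k => //= k ->. Qed.

Lemma cube_ofM k f f' :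
  cube_of k (fun bs => f bs * f' bs)%g = (cube_of k f * cube_of k f')%g.
Proof. by elim: k f f' => //= k IH f f'; rewrite !IH. Qed.

Lemma cube_of_prod (I : Type) (r : seq I) k (f : I -> seq bool -> gT) :
  cube_of k (fun bs => \prod_(j <- r) f j bs)%g = (\prod_(j <- r) cube_of k (f j))%g.
Proof.
elim: r => [|j r IH].
  by rewrite big_nil -[RHS](cube_of1 k); apply/cube_ofP => bs _; rewrite big_nil.
by rewrite big_cons -IH -cube_ofM; apply/cube_ofP => bs _; rewrite big_cons.
Qed.

Lemma cube_of_diag k a f :
  cube_of k (fun bs => a * f bs)%g = (diag k a * cube_of k f)%g.
Proof. by elim: k f => //= k IH f; rewrite !IH. Qed.

Lemma cube_of_vertex_prod k x xs : cube_of k.+1 (vertex_prod (x :: xs)) =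
  add_direction (x, cube_of k (vertex_prod xs)).
Proof.
rewrite /= /add_direction /= -!cube_of_diag.
by congr (_, _); apply/cube_ofP => bs _; rewrite /vertex_prod /= big_cons.
Qed.

Lemma pushwE (T U : finType) (f : T -> U) (w : T -> R) u :
  pushw f w u = \sum_a w a * (f a == u)%:R.
Proof.
rewrite /pushw big_mkcond; apply: eq_bigr => a _.
by case: eqP; rewrite ?mulr1 ?mulr0.
Qed.

Lemma cube_distrE k z : @cube_distr R gT k z =
  iterE (@unif R (gT * gT)%type) k (fun xs => (cube_of k (vertex_prod xs) == z)%:R).
Proof.
elim: k z => [|k IH] z; first by rewrite /= /vertex_prod big_nil eq_sym.
rewrite /cube_distr -/(@cube_distr R gT k) pushwE iterES.
rewrite -(pair_big predT predT (fun x h => unif R x * cube_distr R h *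
  (add_direction (x, h) == z)%:R)) /=.
apply: eq_bigr => x _; under eq_bigr do rewrite -mulrA.
rewrite -big_distrr /=; congr (_ * _).
under eq_bigr do rewrite IH -iterEZr.
rewrite -iterE_sum; apply: eq_iterE => xs _.
under eq_bigr do rewrite eq_sym.
by rewrite sum_delta -cube_of_vertex_prod.
Qed.

Definition ffun_cons (T : Type) n (x : T) (f : {ffun 'I_n -> T}) : {ffun 'I_n.+1 -> T} :=
  [ffun i => if unlift ord0 i is Some j then f j else x].

Lemma iterE_unif_ffun (T : finType) n F : iterE (@unif R T) n F =
  (#|{ffun 'I_n -> T}|%:R)^-1 * \sum_(f : {ffun 'I_n -> T}) F [seq f i | i <- enum 'I_n].
Proof.
have en0 : enum 'I_0 = [::] by apply: size0nil; rewrite -cardE card_ord.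
elim: n F => [|n IH] F.
  have f0 (f : {ffun 'I_0 -> T}) : F [seq f i | i <- enum 'I_0] = F [::] by rewrite en0.
  under eq_bigr do rewrite f0.
  by rewrite sumr_const card_ffun card_ord expn0 mulr1n invr1 mul1r.
rewrite iterES; under eq_bigr do rewrite IH /unif.
have -> : #|{ffun 'I_n.+1 -> T}| = (#|T| * #|{ffun 'I_n -> T}|)%N.
  by rewrite !card_ffun !card_ord expnS.
under eq_bigr do rewrite mulrA -invfM -natrM; rewrite -big_distrr; congr (_ * _) => /=.
rewrite pair_bigA /= (reindex (fun p : T * {ffun 'I_n -> T} => ffun_cons p.1 p.2)) /=.
  apply: eq_bigr => -[x f] _ /=; congr F; rewrite enum_ordSl /= ffunE unlift_none.
  by congr (_ :: _); rewrite -map_comp; apply: eq_map => i /=; rewrite ffunE liftK.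
exists (fun f => (f ord0, [ffun i => f (lift ord0 i)])) => [[x f]|f] _ /=.
  congr (_, _); first by rewrite ffunE unlift_none.
  by apply/ffunP => i; rewrite !ffunE liftK.
apply/ffunP => i; rewrite ffunE; case: unliftP => [j ->|->] //.
by rewrite ffunE.
Qed.

Local Notation Om k t := {ffun 'I_k -> {ffun bool -> t.-tuple gT}}.

Definition column k t (w : Om k t) (j : 'I_t) : {ffun 'I_k -> gT * gT} :=
  [ffun i => (tnth (w i false) j, tnth (w i true) j)].

(** Transposing the array of entries: a sample of [k] pairs of [t]-tuples is the same as [t] columns
    of [k] pairs, and the columns are independent and uniform. *)
Lemma cpow_cube_distr k t z : cpow (@cube_distr R gT k) t z =
  (#|{: Om k t}|%:R)^-1 * \sum_(w : Om k t) ((\prod_(j <- enum 'I_t)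
    cube_of k (vertex_prod [seq column w j i | i <- enum 'I_k]))%g == z)%:R.
Proof.
pose T := {ffun 'I_k -> gT * gT}.
pose phi (f : T) := cube_of k (vertex_prod [seq f i | i <- enum 'I_k]).
have cE : @cube_distr R gT k =1 pushw phi (@unif R T).
  move=> {}z; rewrite pushwE cube_distrE iterE_unif_ffun -big_distrr /=.
  by congr (_ * _).
rewrite cpowE (eq_iterEw _ _ cE) -iterE_push iterE_unif_ffun.
have cardE : #|{ffun 'I_t -> T}| = #|{: Om k t}|.
  rewrite !card_ffun !card_ord card_prod card_bool card_tuple -!expnM mulnn.
  by rewrite -!expnM; congr expn; ring.
rewrite cardE; congr (_ * _).
rewrite (reindex (fun w : Om k t => [ffun j => column w j])) /=.
  apply: eq_bigr => w _; congr ((_ == _)%:R).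
  by rewrite !big_map; apply: eq_bigr => j _; rewrite ffunE.
exists (fun f : {ffun 'I_t -> T} => [ffun i => [ffun b : bool =>
    [tuple (if b then (f j i).2 else (f j i).1) | j < t]]] : Om k t).
  move=> w _; apply/ffunP => i; apply/ffunP => b; apply: eq_from_tnth => j.
  by rewrite !ffunE tnth_mktuple !ffunE; case: b.
move=> f _; apply/ffunP => j; apply/ffunP => i; rewrite !ffunE !tnth_mktuple.
by case: (f j i).
Qed.

Lemma vertex_prod_bits k (x : 'I_k -> gT * gT) (b : 'I_k -> bool) :
  vertex_prod [seq x i | i <- enum 'I_k] [seq b i | i <- enum 'I_k] =
  (\prod_(i <- enum 'I_k) if b i then (x i).2 else (x i).1)%g.
Proof. by rewrite /vertex_prod zip_map big_map. Qed.

End SampleSpace.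

Section MuCoord.
Variable F : finFieldType.

Lemma SL2_prodE (r : seq (SLg F)) : SL2_prod r = (\prod_(g <- r) g)%g.
Proof.
apply: val_inj; rewrite /=; elim: r => [|g r IH]; first by rewrite !big_nil.
by rewrite !big_cons; exact: congr1 IH.
Qed.

Lemma mu_coordE k t (w : sample_space F k t) (e : {ffun 'I_k -> bool}) :
  mu_coord w e = (\prod_(j <- enum 'I_t) vertex_prod
    [seq @column (SLg F) k t w j i | i <- enum 'I_k] [seq e i | i <- enum 'I_k])%g.
Proof.
rewrite /mu_coord /interleave SL2_prodE big_allpairs_dep /=.
apply: eq_bigr => j _; rewrite vertex_prod_bits; apply: eq_bigr => i _.
by rewrite ffunE; case: (e i).
Qed.

Lemma mu_coord_eqP k t (w : sample_space F k t) (g : {ffun 'I_k -> bool} -> SLg F) :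
  ((\prod_(j <- enum 'I_t) cube_of k (vertex_prod
    [seq @column (SLg F) k t w j i | i <- enum 'I_k]))%g ==
   cube_of k (fun bs => g [ffun i : 'I_k => nth false bs i])) =
  [forall e in [set: {ffun 'I_k -> bool}], mu_coord w e == g e].
Proof.
rewrite -cube_of_prod; apply/eqP/forall_inP => [/cube_ofP H e _|H].
  have sz : size [seq e i | i <- enum 'I_k] = k by rewrite size_map size_enum_ord.
  rewrite mu_coordE (H _ sz); apply/eqP; congr (g _).
  apply/ffunP => i; rewrite ffunE (nth_map i) ?size_enum_ord //.
  by rewrite nth_ord_enum.
apply/cube_ofP => bs sz; have := H [ffun i : 'I_k => nth false bs i].
rewrite inE => /(_ isT) /eqP <-; rewrite mu_coordE; apply: eq_bigr => j _.
congr vertex_prod; apply: (@eq_from_nth _ false).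
  by rewrite size_map size_enum_ord.
move=> i; rewrite sz => ik; rewrite (nth_map (Ordinal ik)) ?size_enum_ord //.
by rewrite ffunE -[i in RHS]/(nat_of_ord (Ordinal ik)) nth_enum_ord.
Qed.

End MuCoord.

(* Passage to the real numbers and conclusion *)
From mathcomp Require Import Rstruct.
From Stdlib Require Import Reals.

(** A set of [2^k] coordinates is the whole cube, so the event prescribes a single element of the
    tower. *)
Lemma prob_mu_coord (F : finFieldType) (k t : nat) (S : {set {ffun 'I_k -> bool}})
    (g : {ffun 'I_k -> bool} -> SLg F) : #|S| = expn 2 k ->
  prob (fun w : sample_space F k t => [forall e in S, mu_coord w e == g e]) =
  cpow (@cube_distr Rdefinitions.R (SLg F) k) t
    (cube_of k (fun bs => g [ffun i : 'I_k => nth false bs i])).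
Proof.
move=> cardS.
have {cardS} -> : S = [set: {ffun 'I_k -> bool}].
  apply/eqP; rewrite eqEcard subsetT /= cardsT card_ffun card_bool card_ord.
  by rewrite cardS leqnn.
rewrite cpow_cube_distr /prob RdivE !INRE mulrC -sum1_card natr_sum big_mkcond /=.
congr (_ * _); apply: eq_bigr => w _.
by rewrite mu_coord_eqP unfold_in; case: [forall e in _, _].
Qed.

(** Since [s <= t], the integer part of [t / s] is at least [t / (2 s)], hence at least [t / b]. *)
Lemma Rpower_neg_le (N b : R) (t s : nat) : 1 <= N -> (0 < s)%nat -> (s <= t)%nat ->
  (2 * s)%:R <= b -> N^-1 ^+ (t %/ s) <= Rpower N (- (t%:R / b)).
Proof.
move=> N1 s0 st sb; have N0 : 0 < N by apply: lt_le_trans N1.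
rewrite exprVn -RpowE -RinvE -Rpower_pow; last exact/RltP.
rewrite -Rpower_Ropp; apply/RleP; apply: Rle_Rpower; first exact/RleP.
apply/RleP; rewrite RoppE lerN2 INRE.
have b0 : 0 < b by apply: lt_le_trans sb; rewrite ltr0n muln_gt0.
rewrite ler_pdivrMr //; apply: le_trans (ler_wpM2l (ler0n _ _) sb).
rewrite -natrM ler_nat {1}(divn_eq t s).
have d0 : (0 < t %/ s)%nat by rewrite divn_gt0.
have := ltn_pmod t s0; nia.
Qed.

Lemma near_unif_bounds (T : finType) (d e M : R) (f : T -> R) (z : T) :
  near_unif d f -> d <= e -> #|T|%:R = M -> 0 < M ->
  (1 - e) / M <= f z /\ f z <= (1 + e) / M.
Proof.
move=> /(_ z) nf de <- M0; move: (le_trans nf de); rewrite ler_norml => /andP[lo up].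
by rewrite ler_pdivrMr // ler_pdivlMr //; split; lra.
Qed.

Lemma Nat_pow2E k : Nat.pow 2 k = expn 2 k.
Proof. by elim: k => //= k ->; rewrite expnS; lia. Qed.

Lemma mu_coord_good (F : finFieldType) (k t : nat) : (625 <= #|F|)%nat ->
  (1 <= k)%nat -> (2 ^+ 18 : R) ^+ expn 2 k <= t%:R ->
  good (@mu_coord F k t)
    (Rpower #|SL2 F|%:R (- (t%:R / (2 ^+ 18) ^+ expn 2 k))) (expn 2 k).
Proof.
move=> q_large k0 tb.
have [s [s0 sb nu]] := cube_mixing R q_large k0.
have sb' : (2 * s)%:R <= (2 ^+ 18 : R) ^+ expn 2 k.
  by rewrite -exprM -natrX ler_nat.
have st : (s <= t)%nat.
  have := le_trans sb' tb; rewrite ler_nat; apply: leq_trans.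
  by rewrite leq_pmull.
have N1 : 1 <= #|{: SLg F}|%:R :> R.
  by apply: le_trans (card_SL_large R q_large); rewrite ler1n.
move=> S cardS g; rewrite (@prob_mu_coord F k t S g cardS).
have nt := cube_mixing_rate s0 st nu.
set z := cube_of k _.
have NM : #|tower (SLg F) k|%:R = (#|{: SLg F}|%:R : R) ^+ expn 2 k.
  by rewrite card_tower natrX.
have M0 : 0 < (#|{: SLg F}|%:R : R) ^+ expn 2 k by rewrite exprn_gt0 // (lt_le_trans _ N1).
have [lo up] := near_unif_bounds z nt (Rpower_neg_le N1 s0 st sb') NM M0.
by rewrite INRE RpowE; split; apply/RleP.
Qed.

Local Close Scope ring_scope.

Theorem mainTheorem16 :
  exists (b : R) (q0 : nat), Rlt 0 b /\
  forall (F : finFieldType), (q0 <= #|{: F}|)%N ->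
  forall (k t : nat), (1 <= k)%N ->
  Rle (pow b (2 ^ k)) (INR t) ->
  good (@mu_coord F k t)
       (Rpower (INR #|SL2 F|) (Ropp (Rdiv (INR t) (pow b (2 ^ k)))))
       (2 ^ k).
Proof.
(* The base [2^18] comes from [step_length_le], and 625 from [mean_lam_SL]. *)
exists (GRing.exp (GRing.natmul (GRing.one _) 2) 18 : R), 625%nat; split.
  by apply/RltP; rewrite exprn_gt0 // ltr0n.
move=> F q_large k t k0 /RleP; rewrite Nat_pow2E !INRE RpowE => tb.
exact: mu_coord_good.
Qed.
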